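(* Let $S\in\Gamma_{1,2}$ with $\operatorname{tr}S>2$. Let $\mathcal N$ be an infinite set of odd integers admissible for $S$. For each $N\in\mathcal N$ let $|\Psi\rangle_N=|\Phi_l\rangle_{N,\hat 0}$ be a crystal eigenstate of $U_S$ in $\mathcal H_{N,\hat0}$ (built from some free principal eigenmodule $\Lambda$ of $S$ modulo $N$ and some $l=l(N)\in\mathbb Z/N\mathbb Z$), and assume that $g=\gcd(N,l)\to\infty$ as $N\to\infty$, $N\in\mathcal N$. Then, as $N\to\infty$, $N\in\mathcal N$, both the Husimi measures $H_{\Psi_N}(q,p)\,dq\,dp$ and the atomic probability measures $\mu_N$ describing the zero patterns of $H_{\Psi_N}$ converge weak-$*$ to the Liouville measure $dq\,dp$ on $\mathbb T^2=(\mathbb R/\mathbb Z)^2$.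
   Context: **Quantum setting.** $\Gamma_{1,2}\subset \mathrm{SL}(2,\mathbb Z)$ is the subgroup of matrices congruent mod 2 to $\begin{pmatrix}1&0\\ 0&1\end{pmatrix}$ or $\begin{pmatrix}0&1\\ 1&0\end{pmatrix}$. Put $\hbar=1/(2\pi N)$. For $S=\begin{pmatrix}a&b\\ c&d\end{pmatrix}\in\mathrm{SL}(2,\mathbb R)$, $z\in\mathbb C$, $q\in\mathbb R$, set $$\langle z|U_S|q\rangle=\frac{1}{(\pi\hbar)^{1/4}}\frac1{j_S}\exp\Big\{\frac{1}{2\hbar(ib+d)}\big(-(d-ib)z^2-(a-ic)q^2+2\sqrt2\,zq\big)\Big\},$$ where $j_S$ is a fixed square root of $ib+d$ (so $U_S$ is defined up to sign); for $S$ the identity (with $j_S=1$) this is $\langle z|q\rangle=(\pi\hbar)^{-1/4}e^{-\frac1{2\hbar}(z^2+q^2)+\frac{\sqrt2}{\hbar}zq}$. Let $\hat0=\frac{1+i}2$ (antiperiodic states). For $q\in\frac1N(\frac12+\mathbb Z)$ the state $|q\rangle_{N,\hat0}$ is represented by the entire (Bargmann) function $\langle z|q\rangle_{N,\hat0}=\sum_{m\in\mathbb Z}(-1)^m\langle z|q+m\rangle$. The $N$ states with $q=(j+\frac12)/N$, $j=0,\dots,N-1$, form an orthonormal basis of the Hilbert space $\mathcal H_{N,\hat0}$. For $S\in\Gamma_{1,2}$, $U_S$ acts as a unitary operator on $\mathcal H_{N,\hat0}$ by $\langle z|U_S|q\rangle_{N,\hat0}=\sum_{m\in\mathbb Z}(-1)^m\langle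 z|U_S|q+m\rangle$, and $U_{S'}U_{S''}=\pm U_{S'S''}$. **Eigenmodules.** A free principal eigenmodule of $S$ modulo $N$ is a submodule $\Lambda=\{n\vec v\}$ of $(\mathbb Z/N\mathbb Z)^2$ with exactly $N$ elements, generated by one vector $\vec v$ with $S\vec v\equiv\lambda\vec v$ mod $N$ for some $\lambda$. $N$ is admissible (for $S$) if such a $\Lambda$ exists. **Crystal eigenstates.** Let $N$ be odd admissible, $\Lambda$ a free principal eigenmodule. Choose a generator $\vec v=\begin{pmatrix} k' \\ k \end{pmatrix}$ of $\Lambda$ with $k,k'$ coprime integers of opposite parity, and integers $u,w$ such that $S_{\vec v}=\begin{pmatrix} u & k' \\ w & k \end{pmatrix}\in\Gamma_{1,2}$. Let $\lambda'=k(au+bw)-k'(cu+dw)$, which is inverse to $\lambda$ modulo $N$. For $l\in\mathbb Z/N\mathbb Z$ (represented by $0\le l\le N-1$) put $|\psi_l\rangle_{N,\hat0}=U_{S_{\vec v}}|\tfrac12-\tfrac lN\rangle_{N,\hat0}$. These form an orthonormal basis of $\mathcal H_{N,\hat0}$ and satisfy $U_S|\psi_l\rangle_{N,\hat0}=e^{2i\pi\sigma(N,l)}|\psi_{\lambda'l}\rangle_{N,\hat0}$ with real phases $\sigma(N,l)$. Partition $\mathbb Z/N\mathbb Z$ into the orbits $\mathcal O_j=\{\lambda'^sl_j:\ s=0,\dots,p_j-1\}$ of multiplication by $\lambda'$, with $l_j\in\mathcal O_j$ a chosen representative and $p_j=\#\mathcal O_j$, and put $\sigma_j=\sum_{s=0}^{p_j-1}\sigma(N,\lambda'^sl_j)$.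 For $r=0,\dots,p_j-1$ define $$|\Phi_{l_j\lambda'^r}\rangle_{N,\hat0}=\frac1{\sqrt{p_j}}\sum_{s=0}^{p_j-1}c^{(r)}_s|\psi_{\lambda'^sl_j}\rangle_{N,\hat0},\qquad c_{s+1}^{(r)}=e^{-2i\pi(r+\sigma_j)/p_j}e^{2i\pi\sigma(N,\lambda'^sl_j)}c_s^{(r)},$$ with $c_0^{(r)}$ an arbitrary complex number of modulus 1. This is a normalized eigenstate of $U_S$ with eigenvalue $e^{2i\pi(r+\sigma_j)/p_j}$. Letting $j$ and $r$ vary defines the crystal eigenstates $|\Phi_l\rangle_{N,\hat0}$ for all $l\in\mathbb Z/N\mathbb Z$. Convention: $\gcd(N,0)=N$. **Measures.** With $z=(q-ip)/\sqrt2$, the Husimi density of a normalized $|\psi\rangle\in\mathcal H_{N,\hat0}$ is $H_\psi(q,p)=|\langle z|\psi\rangle|^2e^{-2\pi N|z|^2}$; it is $\mathbb Z^2$-periodic in $(q,p)$ and $H_\psi\,dq\,dp$ is a probability measure on $\mathbb T^2$. The function $\langle z|\psi\rangle$ has exactly $N$ zeros (with multiplicity) modulo $\frac1{\sqrt2}(\mathbb Z+i\mathbb Z)$, i.e. $N$ points $(q_k,p_k)\in\mathbb T^2$; the atomic measure is $\mu_N=\frac1N\sum_{k=1}^N\delta_{(q_k,p_k)}$. Weak-$*$ convergence means convergence of integrals of every continuous function on $\mathbb T^2$. *)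

(* Defs.v *)
From HB Require Import structures.
From mathcomp Require Import all_boot all_order all_algebra.
From mathcomp Require Import all_classical all_reals all_analysis.
From mathcomp Require Export complex.

Set Implicit Arguments.
Unset Strict Implicit.
Unset Printing Implicit Defensive.

Import Order.TTheory GRing.Theory Num.Theory.
Import numFieldNormedType.Exports.

Local Open Scope classical_set_scope.
Local Open Scope ring_scope.
Local Open Scope complex_scope.

(* Reduction of integer vectors modulo N > 0.  The cyclic group Z/NZ is
   'I_N.-1.+1 (trivial for N = 1, whereas 'Z_1 would be Z/2Z). *)
Notation residue N := 'I_N.-1.+1.

Definition vec_mod (N : nat) (v : 'cV[int]_2) : 'cV[residue N]_2 :=
  map_mx (fun x : int => Zp1 *~ x) v.

Definition mx2 (T : Type) (a b c d : T) : 'M[T]_2 :=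
  \matrix_(i, j) if i == 0 then (if j == 0 then a else b)
                 else (if j == 0 then c else d).

Definition vec2 (T : Type) (x y : T) : 'cV[T]_2 :=
  \col_i if i == 0 then x else y.

Definition Gamma12 (S : 'M[int]_2) : Prop :=
  \det S = 1 /\
  ((forall i j, S i j = (mx2 1 0 0 1 : 'M[int]_2) i j %[mod 2])%Z \/
   (forall i j, S i j = (mx2 0 1 1 0 : 'M[int]_2) i j %[mod 2])%Z).

Definition generated_by (N : nat) (v : 'cV[int]_2)
    (L : {set 'cV[residue N]_2}) : Prop :=
  forall x, x \in L <-> exists n : int, x = vec_mod N (n *: v).

Definition free_principal_eigenmodule (S : 'M[int]_2) (N : nat)
    (L : {set 'cV[residue N]_2}) : Prop :=
  #|L| = N /\
  exists (v : 'cV[int]_2) (lam : int),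
    generated_by v L /\ vec_mod N (S *m v) = vec_mod N (lam *: v).

Definition admissible (S : 'M[int]_2) (N : nat) : Prop :=
  exists L : {set 'cV[residue N]_2}, free_principal_eigenmodule S L.

Section Quantum.
Variable R : realType.
Local Notation C := (R[i]).

Definition cexp (z : C) : C :=
  (expR (complex.Re z) * cos (complex.Im z)) +i*
  (expR (complex.Re z) * sin (complex.Im z)).

Definition e2pi (t : R) : C := cos (2 * pi * t) +i* sin (2 * pi * t).

(* Used only for absolutely convergent series, so that the order of
   summation is immaterial. *)
Definition sumZ (F : int -> C) : C :=
  let s n := \sum_(k < n.*2.+1) F (k%:Z - n%:Z) in
  (limn (fun n => complex.Re (s n))) +i* (limn (fun n => complex.Im (s n))).

Definition hbar (N : nat) : R := (2 * pi * N%:R)^-1.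

(* j S is the chosen square root of i b + d. *)
Definition root_choice (j : 'M[R]_2 -> C) : Prop :=
  j 1%:M = 1 /\
  forall S : 'M[R]_2, \det S = 1 -> j S ^+ 2 = S 1 1 +i* S 0 1.

(* <z|U_S|q>; for S = 1 this is <z|q>. *)
Definition bargmann_kernel (j : 'M[R]_2 -> C) (N : nat) (S : 'M[R]_2)
    (q : R) (z : C) : C :=
  let a := S 0 0 in let b := S 0 1 in let c := S 1 0 in let d := S 1 1 in
  (((pi * hbar N) `^ (1 / 4))^-1)%:C * (j S)^-1 *
  cexp (((2 * hbar N)%:C * (d +i* b))^-1 *
        (- (d -i* b) * z ^+ 2 - (a -i* c) * (q ^+ 2)%:C
         + (2 * Num.sqrt 2 * q)%:C * z)).

(* <z|U_S|q>_{N, (1+i)/2}; states are represented by their Bargmann functions. *)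
Definition Uket (j : 'M[R]_2 -> C) (N : nat) (S : 'M[int]_2) (q : R) (z : C) : C :=
  sumZ (fun m => (-1) ^ m * bargmann_kernel j N (map_mx intr S) (q + m%:~R) z).

Definition ket (j : 'M[R]_2 -> C) (N : nat) (q : R) : C -> C :=
  Uket j N 1%:M q.

Definition basis_pt (N : nat) (i : 'I_N) : R := (i%:R + 1 / 2) / N%:R.

(* U_S phi = psi, where U_S is the linear operator on the span of the basis
   states given by its values on this basis. *)
Definition U_maps (j : 'M[R]_2 -> C) (N : nat) (S : 'M[int]_2)
    (phi psi : C -> C) : Prop :=
  exists a : 'I_N -> C,
    (forall z, phi z = \sum_(i < N) a i * ket j N (basis_pt i) z) /\
    (forall z, psi z = \sum_(i < N) a i * Uket j N S (basis_pt i) z).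

Definition psi_state (j : 'M[R]_2 -> C) (N : nat) (Sv : 'M[int]_2)
    (l : residue N) : C -> C :=
  Uket j N Sv (1 / 2 - l%:R / N%:R).

Fixpoint crystal_coef (c0 : C) (sg : nat -> R) (r p : nat) (sgj : R) (s : nat) : C :=
  if s is s'.+1 then
    e2pi (- ((r%:R + sgj) / p%:R)) * e2pi (sg s') *
    crystal_coef c0 sg r p sgj s'
  else c0.

(* Phi = |Phi_l>_{N, (1+i)/2} for some choice of the auxiliary data entering
   its construction; l0 is the representative of the orbit of l and p the
   cardinal of that orbit. *)
Definition crystal_eigenstate (j : 'M[R]_2 -> C) (S : 'M[int]_2) (N : nat)
    (l : residue N) (Phi : C -> C) : Prop :=
  exists (L : {set 'cV[residue N]_2}) (k' k u w : int)
         (sigma : residue N -> R) (l0 : residue N) (r : nat) (c0 : C),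
  let Sv := mx2 u k' w k in
  let lam' := k * (S 0 0 * u + S 0 1 * w) - k' * (S 1 0 * u + S 1 1 * w) in
  let orb (s : nat) : residue N := l0 *~ (lam' ^+ s) in
  let p := order (fun x : residue N => x *~ lam') l0 in
  let sigmaj := \sum_(s < p) sigma (orb s) in
  [/\ free_principal_eigenmodule S L, generated_by (vec2 k' k) L,
      coprimez k' k, ~~ (2 %| k' + k)%Z & Gamma12 Sv] /\
  [/\ forall m : residue N,
        U_maps j N S (psi_state j Sv m)
          (fun z => e2pi (sigma m) * psi_state j Sv (m *~ lam') z),
      (r < p)%N, l = orb r, `|c0| = 1
    & forall z, Phi z = ((Num.sqrt p%:R)^-1)%:C *
        \sum_(s < p) crystal_coef c0 (sigma \o orb) r p sigmaj s *
                     psi_state j Sv (orb s) z].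

Definition phase_pt (x : R * R) : C :=
  (x.1 / Num.sqrt 2) -i* (x.2 / Num.sqrt 2).

Definition husimi (N : nat) (psi : C -> C) (x : R * R) : R :=
  let z := phase_pt x in
  complex.Re (`|psi z| ^+ 2) *
  expR (- (2 * pi * N%:R * complex.Re (`|z| ^+ 2))).

(* The entire function f vanishes at z0 to order exactly n; derivability is
   over the scalar field C, so g is entire. *)
Definition zero_order (f : C -> C) (z0 : C) (n : nat) : Prop :=
  exists g : C^o -> C^o,
    [/\ forall z : C^o, derivable g z 1, g z0 != 0
      & forall z, f z = (z - z0) ^+ n * g z].

(* The points of the torus (R/Z)^2 are represented in [0,1) x [0,1). *)
Definition torus_pt (x : R * R) : Prop :=
  (0 <= x.1 < 1) && (0 <= x.2 < 1).

(* pts lists the N zeros of psi on the torus, repeated according to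
   multiplicity. *)
Definition zeros_list (N : nat) (psi : C -> C) (pts : 'I_N -> R * R) : Prop :=
  (forall k, torus_pt (pts k)) /\
  forall x, torus_pt x -> zero_order psi (phase_pt x) #|[set k | pts k == x]%SET|.

Definition torus_continuous (f : R * R -> R) : Prop :=
  continuous f /\
  forall x y, f (x + 1, y) = f (x, y) /\ f (x, y + 1) = f (x, y).

(* A measure on the torus is given by the integrals of continuous periodic
   functions against it. *)
Definition liouville_measure (f : R * R -> R) : R :=
  \int[(lebesgue_measure \x lebesgue_measure)%E]_(x in `[0, 1] `*` `[0, 1]) f x.

Definition husimi_measure (N : nat) (psi : C -> C) (f : R * R -> R) : R :=
  liouville_measure (fun x => f x * husimi N psi x).

Definition atomic_measure (N : nat) (pts : 'I_N -> R * R) (f : R * R -> R) : R :=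
  N%:R^-1 * \sum_(k < N) f (pts k).

Definition weak_star_cvg (A : set nat) (mu : nat -> (R * R -> R) -> R)
    (nu : (R * R -> R) -> R) : Prop :=
  forall f, torus_continuous f ->
    mu N f @[N --> within A \oo] --> nu f.

End Quantum.

(* Main.v *)
Require Import Defs.
From HB Require Import structures.
From mathcomp Require Import all_boot all_order all_algebra.
From mathcomp Require Import all_classical all_reals all_analysis.
From mathcomp Require Import ring lra zify.

(** Put [y = S_v^-1 x].  In these coordinates the Husimi density of a crystal
    state is a constant times [|sum_l c_l theta_l(y)|^2], where
    [theta_l(y) = sum_m (-1)^m G(y1 - q_l - m) e(-N (q_l + m) y2)], [q_l = 1/2 - l/N]
    and [G] is a complex Gaussian.  All indices [l] of the orbit are multiples of
    [g = gcd(N, l)], so translating [y2] by [1/g] multiplies every term by the same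
    phase: the density is invariant under translation by [v/g], and so is the
    multiset of zeros, whose multiplicities can be read off from the density.
    The density has mass 1 because the frequencies [N (q_l + m)] are distinct:
    Parseval in [y2], and unfolding of the sum over [m] in [y1], leave a Gaussian
    integral.

    The multiples of [v/g] modulo [Z^2] form an S-invariant lattice [M].  By
    pigeonhole it contains a nonzero vector [X] of size [O(g^(-1/2))]; since [S] is
    hyperbolic, [X] and [S X] are independent, so [M] is [O(g^(-1/2))]-dense.  The
    average over [M] of a continuous function on the torus is therefore almost
    constant, hence any two M-invariant probability measures, in particular the
    given one and Lebesgue measure, almost agree on it. *)

Set Implicit Arguments.
Unset Strict Implicit.
Unset Printing Implicit Defensive.
Import Order.TTheory GRing.Theory Num.Theory.
Import numFieldNormedType.Exports.
Local Open Scope classical_set_scope.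
Local Open Scope ring_scope.
Local Open Scope complex_scope.

(** * Integration on the torus *)

(** The matrix S_v changes with N and nothing bounds its entries, so the shape of the density in the
    original coordinates is out of control and pointwise estimates are hopeless. Only facts
    insensitive to an integral change of basis are extracted from the quantum side: positivity, mass
    one, periodicity and invariance under v/g. What remains concerns lattices, and its thresholds
    must depend on S and on the precision alone, never on v or on the eigenvalue. This is why the
    fixed hyperbolic matrix S supplies the second lattice direction: v is an eigenvector modulo N,
    hence modulo g, which makes M stable under S. Both families of measures then obey one criterion,
    stated for positive normalized functionals on continuous periodic functions. The same averaging
    argument, run on an explicit fine grid instead of M, proves that SL(2,Z) preserves Lebesgue
    measure; this transports the mass computed in the y-coordinates back to the x-coordinates. *)

Section Torus.
Variable R : realType.
Notation mu := (@lebesgue_measure R).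
Implicit Types f g : R * R -> R.

Lemma continuous2P f : continuous f <->
  forall x e, 0 < e -> exists2 d, 0 < d &
    forall y, `|y.1 - x.1| < d -> `|y.2 - x.2| < d -> `|f y - f x| < e.
Proof.
split=> [cf x e e0|H x].
  have /cvgrPdist_lt/(_ _ e0) Hx := cf x.
  have /(@nbhs_ballP R (R * R)%type)[d /= d0 Hd] : nbhs x (fun t => `|f x - f t| < e) by exact: Hx.
  exists d => // y y1 y2.
  by rewrite distrC; apply: Hd; split; rewrite /ball /= distrC.
apply/cvgrPdist_lt => e e0; have [d d0 Hd] := H x e e0.
apply/(@nbhs_ballP R (R * R)%type); exists d => // y [y1 y2]; rewrite distrC.
by apply: Hd; rewrite distrC.
Qed.

(** The product sigma-algebra is built from rectangles, so an open set has to be exhausted by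
    countably many of them: the boxes with rational corners inside [A], enumerated through
    [unpickle]. *)
Lemma open_measurable_prod (A : set (R * R)) : open A -> measurable A.
Proof.
move=> oA.
pose box (q : rat * rat * rat * rat) : set (R * R) :=
  `]ratr q.1.1.1, ratr q.1.1.2[ `*` `]ratr q.1.2, ratr q.2[.
pose F n : set (R * R) := match unpickle n with
  Some q => if `[< box q `<=` A >] then box q else set0 | None => set0 end.
have -> : A = \bigcup_n F n.
  rewrite eqEsubset; split=> [x Ax|x [n _]]; last first.
    by rewrite /F; case: unpickle => // q; case: asboolP => // + Hx; exact.
  have := oA; rewrite openE => /(_ x Ax); rewrite /interior.
  move/(@nbhs_ballP R (R * R)%type) => [d /= d0 Hd].
  have rat_near (t : R) : exists ab : rat * rat,
     ratr ab.1 < t < ratr ab.2 /\ t - d < ratr ab.1 /\ ratr ab.2 < t + d.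
    have [a] := @rat_in_itvoo R (t - d) t ltac:(by rewrite ltrBlDr ltrDl).
    rewrite in_itv/= => /andP[a1 a2].
    have [b] := @rat_in_itvoo R t (t + d) ltac:(by rewrite ltrDl).
    rewrite in_itv/= => /andP[b1 b2].
    by exists (a, b); rewrite /= a1 a2 b1 b2.
  have [[a b] /= [/andP[a1 b1] [a2 b2]]] := rat_near x.1.
  have [[a' b'] /= [/andP[a1' b1'] [a2' b2']]] := rat_near x.2.
  exists (pickle (a, b, a', b')); first exact: I.
  rewrite /F pickleK.
  case: asboolP => [_|].
    by split; rewrite /= in_itv/= ?a1 ?b1 ?a1' ?b1'.
  case; move=> y [] /=; rewrite !in_itv/= => /andP[y1 y2] /andP[y3 y4].
  by apply: Hd; split; rewrite /ball /=; apply/ltr_normlP; split; lra.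
apply: bigcup_measurable => n _; rewrite /F; case: unpickle => // q.
by case: ifP => // _; apply: measurableX; exact: measurable_itv.
Qed.

Lemma continuous2_measurable f : continuous f -> measurable_fun setT f.
Proof.
move=> cf; apply: (measurability _ (measurable_realfun.RGenOInfty.measurableE R)).
move=> _ [_ [a ->] <-].
rewrite setTI; apply: open_measurable_prod; exact: open_comp.
Qed.

Definition unit_square : set (R * R) := `[0, 1] `*` `[0, 1].

Lemma measurable_unit_square : measurable unit_square.
Proof. by apply: measurableX; exact: measurable_itv. Qed.

Lemma unit_square_compact : compact (unit_square : set (R * R)).
Proof. by apply: compact_setX; exact: segment_compact. Qed.

Lemma unit_square_measure : (mu \x mu)%E unit_square = 1%E.
Proof.
rewrite product_measure1E; [|exact: measurable_itv|exact: measurable_itv].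
by rewrite /= lebesgue_measure_itv /= lte_fin ltr01 ?oppr0 ?adde0 ?mule1 ?oppe0 ?adde0 ?mule1.
Qed.

Lemma continuous_unit_square_bounded f : continuous f ->
  exists2 M, 0 <= M & forall x, unit_square x -> `|f x| <= M.
Proof.
move=> cf; have cf' : {within unit_square, continuous f}.
  exact: continuous_subspaceT.
have /compact_bounded[M [_ HM]] :=
  continuous_compact cf' unit_square_compact.
exists (`|M| + 1); first by rewrite addr_ge0.
move=> x Hx; apply: (HM (`|M| + 1)); last by exists x.
by rewrite (le_lt_trans (ler_norm _))// ltrDl.
Qed.

Lemma continuous2_integrable f : continuous f ->
  (mu \x mu)%E.-integrable unit_square (EFin \o f).
Proof.
move=> cf; apply: measurable_bounded_integrable.
- exact: measurable_unit_square.
- by rewrite [ltLHS]unit_square_measure ltry.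
- by apply: measurable_funTS; exact: continuous2_measurable.
- have [M M0 HM] := continuous_unit_square_bounded cf.
  exists M; split; rewrite ?num_real // => y My x Hx.
  exact: le_trans (HM x Hx) (ltW My).
Qed.

End Torus.

Section Torus_integral.
Variable R : realType.
Notation mu := (@lebesgue_measure R).
Implicit Types f g : R * R -> R.

Lemma continuous_integrable (h : R -> R) (a b : R) : continuous h ->
  mu.-integrable `[a, b] (EFin \o h).
Proof.
move=> ch; apply: continuous_compact_integrable; first exact: segment_compact.
exact: continuous_subspaceT.
Qed.

Lemma continuous_uncurry f (T : topologicalType) (u v : T -> R) :
  continuous f -> continuous u -> continuous v ->
  continuous (fun t => f (u t, v t)).
Proof.
move=> cf cu cv t; apply: (cvg_comp (fun t => (u t, v t)) f); last exact: cf.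
exact: (cvg_pair (cu t) (cv t)).
Qed.

Lemma continuous_pair_l f x : continuous f -> continuous (fun y => f (x, y)).
Proof.
by move=> cf; apply: (@continuous_uncurry f _ (fun=> x) id) => // y; [exact: cvg_cst|exact: cvg_id].
Qed.

Lemma continuous_pair_r f y : continuous f -> continuous (fun x => f (x, y)).
Proof.
by move=> cf; apply: (@continuous_uncurry f _ id (fun=> y)) => // x; [exact: cvg_id|exact: cvg_cst].
Qed.

Lemma liouville_iterl f : continuous f ->
  liouville_measure f =
  \int[mu]_(x in `[0, 1]) \int[mu]_(y in `[0, 1]) f (x, y).
Proof.
move=> cf; rewrite /liouville_measure /Rintegral; congr fine.
rewrite integral_mkcond -integral12_prod_meas1; last first.
  by rewrite -integrable_mkcond; [exact: continuous2_integrable|exact: measurable_unit_square].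
rewrite [RHS]integral_mkcond; apply: eq_integral => x _.
rewrite /fubini_F /= patchE; case: ifPn => xD.
- rewrite fineK; last first.
    apply: integrable_fin_num; first exact: measurable_itv.
    by apply: continuous_integrable; exact: continuous_pair_l.
  rewrite [RHS]integral_mkcond; apply: eq_integral => y _.
  by rewrite !patchE in_setX xD.
- by rewrite integral0_eq// => y _; rewrite patchE in_setX (negbTE xD).
Qed.

Lemma liouville_iterr f : continuous f ->
  liouville_measure f =
  \int[mu]_(y in `[0, 1]) \int[mu]_(x in `[0, 1]) f (x, y).
Proof.
move=> cf; rewrite /liouville_measure /Rintegral; congr fine.
rewrite integral_mkcond -integral21_prod_meas1; last first.
  by rewrite -integrable_mkcond; [exact: continuous2_integrable|exact: measurable_unit_square].
rewrite [RHS]integral_mkcond; apply: eq_integral => y _.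
rewrite /fubini_G /= patchE; case: ifPn => yD.
- rewrite fineK; last first.
    apply: integrable_fin_num; first exact: measurable_itv.
    by apply: continuous_integrable; exact: continuous_pair_r.
  rewrite [RHS]integral_mkcond; apply: eq_integral => x _.
  by rewrite !patchE in_setX yD andbT.
- by rewrite integral0_eq// => x _; rewrite patchE in_setX (negbTE yD) andbF.
Qed.

Lemma liouvilleD f g : continuous f -> continuous g ->
  liouville_measure (fun x => f x + g x) = liouville_measure f + liouville_measure g.
Proof.
by move=> cf cg; rewrite /liouville_measure RintegralD//;
  [exact: measurable_unit_square|exact: continuous2_integrable..].
Qed.

Lemma liouvilleZl f r : continuous f ->
  liouville_measure (fun x => r * f x) = r * liouville_measure f.
Proof.
by move=> cf; rewrite /liouville_measure RintegralZl//;
  [exact: measurable_unit_square|exact: continuous2_integrable].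
Qed.

Lemma le_liouville f g : continuous f -> continuous g ->
  (forall x, unit_square x -> f x <= g x) ->
  liouville_measure f <= liouville_measure g.
Proof.
move=> cf cg fg; rewrite /liouville_measure le_Rintegral//;
  [exact: measurable_unit_square|exact: continuous2_integrable..].
Qed.

Lemma liouville_cst (r : R) : liouville_measure (fun=> r) = r.
Proof.
rewrite /liouville_measure Rintegral_cst; last exact: measurable_unit_square.
by rewrite [X in fine X]unit_square_measure mulr1.
Qed.

Lemma Rintegral_shift (h : R -> R) (a u v : R) : continuous h -> u <= v ->
  \int[mu]_(x in `[u, v]) h (x + a) = \int[mu]_(x in `[u + a, v + a]) h x.
Proof.
move=> ch uv; rewrite /Rintegral; congr fine; apply/esym.
have dE (x : R) : is_derive x 1 (fun t : R => t + a) 1.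
  by rewrite -[X in is_derive _ _ _ X]addr0; apply: is_deriveD.
have d1 : ((fun t : R => t + a)^`())%classic = cst 1.
  by apply/funext => x; rewrite derive1E; have [] := dE x.
have ca : continuous (fun t : R => t + a).
  by move=> x; apply: differentiable_continuous; apply/derivable1_diffP; have [] := dE x.
rewrite (@integration_by_substitution_increasing _ (fun t => t + a) h u v)//.
- by apply: eq_integral => x _ /=; rewrite d1 /= mulr1.
- by move=> x y _ _ xy; rewrite ltrD2r.
- by move=> x _; rewrite d1; exact: cvg_cst.
- by rewrite d1; exact: is_cvg_cst.
- by rewrite d1; exact: is_cvg_cst.
- split; first by move=> x _; have [] := dE x.
  + by apply: cvg_at_right_filter; exact: ca.
  + by apply: cvg_at_left_filter; exact: ca.
- exact: continuous_subspaceT.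
Qed.

Lemma Rintegral_itv_cat (h : R -> R) (a b c : R) : continuous h ->
  a <= b -> b <= c ->
  \int[mu]_(x in `[a, c]) h x =
  \int[mu]_(x in `[a, b]) h x + \int[mu]_(x in `[b, c]) h x.
Proof.
move=> ch ab bc.
have := @Rintegral_itvB R h (BLeft a) (BRight c) b (continuous_integrable a c ch).
rewrite !bnd_simp => /(_ ab bc) /eqP; rewrite subr_eq => /eqP ->.
rewrite Rintegral_itv_obnd_cbnd 1?addrC//.
by apply: integrableS (continuous_integrable b c ch) => //;
  apply: subset_itvr; rewrite bnd_simp.
Qed.

Lemma periodic_int (h : R -> R) : (forall t, h (t + 1) = h t) ->
  forall (k : int) t, h (t + k%:~R) = h t.
Proof.
move=> h1; elim=> [|k IH|k IH] t; first by rewrite addr0.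
- by rewrite intS intrD (addrC 1%:~R) addrA h1 IH.
- rewrite -[LHS]h1 -[in RHS](IH t); congr h.
  by rewrite intS opprD intrD; ring.
Qed.

(** Once a is reduced to [0, 1), the window [a, 1 + a] is cut at 1 and its right part slides back by
    one period. *)
Lemma Rintegral_periodic (h : R -> R) (a : R) : continuous h ->
  (forall x, h (x + 1) = h x) ->
  \int[mu]_(x in `[0, 1]) h (x + a) = \int[mu]_(x in `[0, 1]) h x.
Proof.
move=> ch h1.
wlog /andP[a0 a1] : a / 0 <= a < 1 => [H|].
  pose b := a - (Num.floor a)%:~R.
  have b01 : 0 <= b < 1.
    by have /andP[] := floor_itv a; rewrite /b intrD subr_ge0 => -> /=; lra.
  rewrite -(H b b01); apply: eq_Rintegral => x _.
  by rewrite -[RHS](periodic_int h1 (Num.floor a)); congr h; rewrite /b; ring.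
rewrite Rintegral_shift// add0r.
rewrite (@Rintegral_itv_cat h a 1 (1 + a)) ?(ltW a1)// ?lerDl//.
rewrite (@Rintegral_itv_cat h 0 a 1) ?(ltW a1)// addrC; congr (_ + _).
have := @Rintegral_shift h 1 0 a ch a0; rewrite add0r addrC => <-.
by apply: eq_Rintegral => x _; rewrite h1.
Qed.
End Torus_integral.

(** * Invariant functionals on the torus *)

Section Torus_functionals.
Variable R : realType.
Implicit Types (f g : R * R -> R) (J : (R * R -> R) -> R) (w : R * R).

Lemma torus_periodic f (m n : int) x : torus_continuous f ->
  f (x + (m%:~R, n%:~R)) = f x.
Proof.
case: x => x y [_ pf].
transitivity (f (x, y + n%:~R)).
  by apply: (@periodic_int R (fun t => f (t, _))) => t; have [] := pf t (y + n%:~R).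
by apply: (@periodic_int R (fun t => f (_, t))) => t; have [] := pf x t.
Qed.

Lemma torus_continuous_shift f a : torus_continuous f ->
  torus_continuous (fun x => f (x + a)).
Proof.
move=> [cf pf]; split.
  move=> x; apply: (cvg_comp (fun x => x + a) f); last exact: cf.
  by apply: cvgD; [exact: cvg_id|exact: cvg_cst].
case: a => a b x y; split.
- have [+ _] := pf (x + a) (y + b); rewrite addrAC; exact.
- have [_ +] := pf (x + a) (y + b); rewrite addrAC; exact.
Qed.

Lemma torus_continuousD f g : torus_continuous f -> torus_continuous g ->
  torus_continuous (fun x => f x + g x).
Proof.
move=> [cf pf] [cg pg]; split; first by move=> x; apply: cvgD; [exact: cf|exact: cg].
by move=> x y; have [-> ->] := pf x y; have [-> ->] := pg x y.
Qed.

Lemma torus_continuousM f g : torus_continuous f -> torus_continuous g ->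
  torus_continuous (fun x => f x * g x).
Proof.
move=> [cf pf] [cg pg]; split; first by move=> x; apply: cvgM; [exact: cf|exact: cg].
by move=> x y; have [-> ->] := pf x y; have [-> ->] := pg x y.
Qed.

Lemma torus_continuous_cst (r : R) : torus_continuous (fun=> r).
Proof. by split => // x; exact: cvg_cst. Qed.

Lemma torus_continuous_sum n (F : 'I_n -> R * R -> R) :
  (forall i, torus_continuous (F i)) ->
  torus_continuous (fun x => \sum_(i < n) F i x).
Proof.
elim: n F => [|n IH] F cF.
  under [X in torus_continuous X]eq_fun do rewrite big_ord0.
  exact: torus_continuous_cst.
under [X in torus_continuous X]eq_fun do rewrite big_ord_recl.
by apply: torus_continuousD; [exact: cF|apply: IH => i; exact: cF].
Qed.

(** Compactness gives one [d] for all base points of the unit square, and periodicity moves any [x]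
    there. The integer translation that does so may leave [y] outside the square, so the covering
    statement lets [y] range over the whole plane. *)
Lemma torus_unif_continuous f e : torus_continuous f -> 0 < e ->
  exists2 d, 0 < d & forall x y : R * R,
    `|x.1 - y.1| < d -> `|x.2 - y.2| < d -> `|f x - f y| < e.
Proof.
move=> tf e0; have [cf _] := tf.
have /compact_near_coveringP/(_ _ (0^'+ : set_system R)
  (fun (d : R) (x : R * R) => forall y : R * R,
    `|x.1 - y.1| < d -> `|x.2 - y.2| < d -> `|f x - f y| < e)) := @unit_square_compact R.
case.
  move=> x _.
  have [r r0 Hr] := (continuous2P f).1 cf x _ (divr_gt0 e0 (ltr0Sn R 1)).
  exists ((ball x (r / 2)), [set d | d < r / 2]) => /=.
    split; last by apply: nbhs_right_lt; rewrite divr_gt0.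
    by apply: (@nbhsx_ballx R (R * R)%type); rewrite divr_gt0.
  move=> [y d] /= [[]]; rewrite /ball /= => y1 y2 dr z z1 z2.
  have -> : f y - f z = (f y - f x) - (f z - f x) by ring.
  rewrite (le_lt_trans (ler_normB _ _))// (splitr e) ltrD//; apply: Hr.
  - by rewrite distrC (lt_trans y1)//; lra.
  - by rewrite distrC (lt_trans y2)//; lra.
  - have -> : z.1 - x.1 = - ((x.1 - y.1) + (y.1 - z.1)) by ring.
    by rewrite normrN (le_lt_trans (ler_normD _ _))//; lra.
  - have -> : z.2 - x.2 = - ((x.2 - y.2) + (y.2 - z.2)) by ring.
    by rewrite normrN (le_lt_trans (ler_normD _ _))//; lra.
move=> d /= d0 Hd; exists (d / 2); first by rewrite divr_gt0.
move=> x y x1 x2.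
have {}Hd : forall z : R * R, unit_square z -> forall y : R * R,
    `|z.1 - y.1| < d / 2 -> `|z.2 - y.2| < d / 2 -> `|f z - f y| < e.
  by apply: Hd; rewrite /= ?divr_gt0// sub0r normrN gtr0_norm ?divr_gt0//; lra.
pose k := (- (Num.floor x.1)) ; pose l := (- (Num.floor x.2)).
rewrite -(torus_periodic k l x tf) -(torus_periodic k l y tf).
apply: Hd.
- have /andP[] := floor_itv x.1; have /andP[] := floor_itv x.2.
  rewrite !intrD => h1 h2 h3 h4.
  by split; rewrite /= in_itv/= /k /l !mulrNz; apply/andP; split; lra.
- by rewrite /= opprD addrACA subrr addr0.
- by rewrite /= opprD addrACA subrr addr0.
Qed.

(** A probability measure on the torus known only through its integrals of continuous periodic
    functions: this is what weak-* convergence tests, and densities and atomic measures share this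
    form. *)
Definition prob_functional J :=
  [/\ forall f g, torus_continuous f -> torus_continuous g ->
        J (fun x => f x + g x) = J f + J g,
      forall r f, torus_continuous f -> J (fun x => r * f x) = r * J f,
      forall f g, torus_continuous f -> torus_continuous g ->
        (forall x, f x <= g x) -> J f <= J g
    & forall r, J (fun=> r) = r].

Definition shift_invariant J w :=
  forall f, torus_continuous f -> J (fun x => f (x + w)) = J f.

Definition orbit_dense w (d : R) := forall y : R * R, exists (n : nat) (k l : int),
  `|n%:R * w.1 + k%:~R - y.1| < d /\ `|n%:R * w.2 + l%:~R - y.2| < d.

Lemma prob_functional_sum J n (F : 'I_n -> R * R -> R) : prob_functional J ->
  (forall i, torus_continuous (F i)) ->
  J (fun x => \sum_(i < n) F i x) = \sum_(i < n) J (F i).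
Proof.
move=> [JD _ _ Jc]; elim: n F => [|n IH] F cF.
  by under [X in J X]eq_fun do rewrite big_ord0; rewrite Jc big_ord0.
under [X in J X]eq_fun do rewrite big_ord_recl.
rewrite JD; [|exact: cF|by apply: torus_continuous_sum => i; exact: cF].
by rewrite IH ?big_ord_recl// => i; exact: cF.
Qed.

(* The average of f over the orbit of w is almost constant. *)
Lemma dist_shift_invariant J I f w (g : nat) (k l : int) (d e : R) :
  prob_functional J -> prob_functional I ->
  shift_invariant J w -> shift_invariant I w ->
  (0 < g)%N -> w *+ g = (k%:~R, l%:~R) -> orbit_dense w d ->
  torus_continuous f ->
  (forall x y : R * R,
    `|x.1 - y.1| < d -> `|x.2 - y.2| < d -> `|f x - f y| <= e) ->
  `|J f - I f| <= e.
Proof.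
move=> pJ pI Jw Iw g0 wg dw tf fe.
pose F x := g%:R^-1 * \sum_(i < g) f (x + w *+ i).
have gR0 : (g%:R : R) != 0 by rewrite pnatr_eq0 -lt0n.
have ts i : torus_continuous (fun x => f (x + w *+ i)).
  exact: torus_continuous_shift.
have tsum : torus_continuous (fun x => \sum_(i < g) f (x + w *+ i)).
  by apply: torus_continuous_sum => i; exact: ts.
have tF : torus_continuous F.
  by apply: torus_continuousM => //; exact: torus_continuous_cst.
have avg L : prob_functional L -> shift_invariant L w -> L F = L f.
  move=> pL Lw; have [_ LZ _ _] := pL.
  have Ln n : L (fun x => f (x + w *+ n)) = L f.
    elim: n => [|n IH]; first by congr L; apply/funext => x; rewrite mulr0n addr0.
    rewrite -IH -(Lw _ (ts n)); congr L; apply/funext => x.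
    by rewrite mulrS addrA.
  rewrite LZ// prob_functional_sum//.
  rewrite (eq_bigr (fun=> L f)); last by move=> i _; exact: Ln.
  by rewrite sumr_const card_ord -[L f *+ g]mulr_natl mulKf.
(* Replacing x by x + w sends each term of the average to the next one; the last becomes the first
   because [w *+ g] is an integer vector. *)
have Fw x : F (x + w) = F x.
  congr (_ * _); case: g g0 wg {F gR0 tsum tF avg} => // g _ wg.
  rewrite big_ord_recr [in RHS]big_ord_recl/= addrC; congr (_ + _).
    by rewrite -addrA -mulrS wg torus_periodic// mulr0n addr0.
  by apply: eq_bigr => i _; rewrite -addrA -mulrS.
have Fn n x : F (x + w *+ n) = F x.
  by elim: n x => [|n IH] x; rewrite ?mulr0n ?addr0// mulrS addrA IH Fw.
have Fper x (m n : int) : F (x + (m%:~R, n%:~R)) = F x by exact: torus_periodic.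
have Fosc x y : `|F x - F y| <= e.
  have [n [m [m' []]]] := dw (x - y).
  have m1 : (w *+ n).1 = n%:R * w.1 by rewrite raddfMn /= mulr_natl.
  have m2 : (w *+ n).2 = n%:R * w.2 by rewrite raddfMn /= mulr_natl.
  move=> h1 h2; rewrite -(Fn n y) -(Fper (y + w *+ n) m m') distrC.
  rewrite /F -mulrBr -sumrB normrM.
  rewrite ger0_norm ?invr_ge0 ?ler0n// ler_pdivrMl ?ltr0n//.
  rewrite (le_trans (ler_norm_sum _ _ _))//.
  rewrite (le_trans (ler_sum _ (G := fun=> e) _)) ?sumr_const ?card_ord ?mulr_natl// => i _.
  apply: fe => /=.
  - by rewrite opprD addrACA subrr addr0 m1; move: h1 => /=; congr (`|_| < _); ring.
  - by rewrite opprD addrACA subrr addr0 m2; move: h2 => /=; congr (`|_| < _); ring.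
(* For fixed y, applying L in x to F x <= F y + e bounds the number L F by F y + e; applying L' in y
   then gives L F <= L' F + e. *)
have osc L L' : prob_functional L -> shift_invariant L w ->
    prob_functional L' -> shift_invariant L' w -> L f <= L' f + e.
  move=> pL Lw pL' Lw'; rewrite -(avg L)// -(avg L')//.
  have [_ _ Lmon Lc] := pL; have [LD' _ Lmon' Lc'] := pL'.
  rewrite -(Lc' e) -LD'//; last exact: torus_continuous_cst.
  rewrite -[leLHS]Lc'; apply: Lmon' => [||y]; first exact: torus_continuous_cst.
    by apply: torus_continuousD => //; exact: torus_continuous_cst.
  rewrite -[leRHS]Lc; apply: Lmon => //; first exact: torus_continuous_cst.
  by move=> x; rewrite addrC -lerBlDr; apply: le_trans (Fosc x y); exact: ler_norm.
by rewrite ler_distlC lerBlDr; apply/andP; split; exact: osc.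
Qed.

Lemma liouville_prob_functional : prob_functional (@liouville_measure R).
Proof.
split.
- by move=> f g [cf _] [cg _]; exact: liouvilleD.
- by move=> r f [cf _]; exact: liouvilleZl.
- by move=> f g [cf _] [cg _] fg; apply: le_liouville.
- exact: liouville_cst.
Qed.

(** One coordinate is shifted at a time, each inside the inner integral of the suitable order of
    integration. *)
Lemma liouville_shift_invariant w : shift_invariant (@liouville_measure R) w.
Proof.
move=> f tf; have [cf pf] := tf.
have [csf _] := torus_continuous_shift w tf.
have cs1 : continuous (fun x : R * R => f (x + (w.1, 0))).
  by have [] := torus_continuous_shift (w.1, 0) tf.
rewrite (liouville_iterl csf).
transitivity (liouville_measure (fun x => f (x + (w.1, 0)))).
  rewrite (liouville_iterl cs1); apply: eq_Rintegral => x _.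
  rewrite -(@Rintegral_periodic R (fun y => f ((x, y) + (w.1, 0))) w.2).
  - by apply: eq_Rintegral => y _; congr f; congr pair; rewrite /= addr0.
  - exact: (@continuous_pair_l _ _ x cs1).
  - move=> y; transitivity (f (x + w.1, y + 1)).
      by congr f; congr pair; rewrite /= addr0.
    have [_ ->] := pf (x + w.1) y.
    by congr f; congr pair; rewrite /= addr0.
rewrite (liouville_iterr cs1) (liouville_iterr cf); apply: eq_Rintegral => y _.
rewrite -(@Rintegral_periodic R (fun x => f (x, y)) w.1).
- by apply: eq_Rintegral => x _; congr f; congr pair; rewrite /= addr0.
- exact: (@continuous_pair_r _ _ y cf).
- by move=> x; have [] := pf x y.
Qed.

Lemma torus_continuous_linear f (S : 'M[int]_2) : torus_continuous f ->
  torus_continuous (fun x => f ((S 0 0)%:~R * x.1 + (S 0 1)%:~R * x.2,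
                                (S 1 0)%:~R * x.1 + (S 1 1)%:~R * x.2)).
Proof.
move=> tf; have [cf pf] := tf; split.
  have c1 : continuous (fun x : R * R => x.1) by move=> x; exact: cvg_fst.
  have c2 : continuous (fun x : R * R => x.2) by move=> x; exact: cvg_snd.
  by apply: continuous_uncurry => // x; apply: cvgD; apply: cvgM;
    try exact: cvg_cst; [exact: c1|exact: c2|exact: c1|exact: c2].
move=> x y; split=> /=.
  rewrite -[RHS](torus_periodic (S 0 0) (S 1 0) _ tf); congr f; congr pair => /=; ring.
rewrite -[RHS](torus_periodic (S 0 1) (S 1 1) _ tf); congr f; congr pair => /=; ring.
Qed.
End Torus_functionals.

(** * Invariance of Lebesgue measure on the torus under SL(2,Z) *)

Section SL2_invariance.
Variable R : realType.
Implicit Types f : R * R -> R.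

(** Two digits in base n can be prescribed freely: modulo 1, the multiple of index n a + b has
    coordinates a/n + b/n^2 and b/n. Since b < n, the perturbation b/n^2 stays below the mesh
    1/n. *)
Lemma orbit_dense_grid (n : nat) : (0 < n)%N ->
  orbit_dense ((n%:R ^+ 2)^-1 : R, n%:R^-1 : R) (n%:R^-1).
Proof.
move=> n0 [y1 y2].
have nR : (0 : R) < n%:R by rewrite ltr0n.
have digit (t : R) : exists (a : nat) (k : int),
    (a < n)%N /\ 0 <= t - (a%:R / n%:R + k%:~R) < n%:R^-1.
  have n0' : (n%:Z != 0)%R by rewrite -lt0n.
  have a0 : (0 <= modz (Num.floor (n%:R * t)) n%:Z) by exact: modz_ge0.
  exists `|modz (Num.floor (n%:R * t)) n%:Z|%N, (divz (Num.floor (n%:R * t)) n%:Z); split.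
    by rewrite -ltz_nat gez0_abs// ltz_pmod.
  have -> : `|modz (Num.floor (n%:R * t)) n%:Z|%N%:R / n%:R +
      (divz (Num.floor (n%:R * t)) n%:Z)%:~R = (Num.floor (n%:R * t))%:~R / n%:R :> R.
    rewrite -[_%:R]/(`|modz (Num.floor (n%:R * t)) n%:Z|%N%:Z%:~R) gez0_abs//.
    have := divz_eq (Num.floor (n%:R * t)) n%:Z.
    set q := divz _ _; set r := modz _ _ => ->; clearbody q r.
    by rewrite intrD intrM mulrDl mulfK ?gt_eqF// addrC.
  have /andP[h1 h2] := floor_itv (n%:R * t).
  rewrite -(ltr_pM2l nR) -(pmulr_rge0 _ nR) mulrBr mulrCA divff ?gt_eqF// mulr1.
  by move: h2; rewrite intrD => h2; apply/andP; split; lra.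
have [a [k [an /andP[a1 a2]]]] := digit y1.
have [b [l [bn /andP[b1 b2]]]] := digit y2.
exists (n * a + b)%N, k, (l - a%:Z); split => /=.
  have -> : (n * a + b)%:R * (n%:R ^+ 2)^-1 + k%:~R - y1 =
     b%:R / n%:R / n%:R - (y1 - (a%:R / n%:R + k%:~R)) :> R.
    by rewrite natrD natrM; field; rewrite gt_eqF.
  have b3 : 0 <= (b%:R / n%:R : R) / n%:R by rewrite !divr_ge0.
  have b4 : (b%:R / n%:R : R) / n%:R < n%:R^-1.
    by rewrite -[ltRHS]mul1r ltr_pM2r ?invr_gt0// ltr_pdivrMr// mul1r ltr_nat.
  by apply/ltr_normlP; split; lra.
have -> : (n * a + b)%:R / n%:R + (l - a%:Z)%:~R - y2 =
   - (y2 - (b%:R / n%:R + l%:~R)) :> R.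
  by rewrite natrD natrM intrB; field; rewrite gt_eqF.
by rewrite normrN ger0_norm.
Qed.

(* The image of Lebesgue measure under S is still invariant under the
   grid generated by (n^-2, n^-1), for every n. *)
Lemma liouville_SL2 f (S : 'M[int]_2) : S 0 0 * S 1 1 - S 0 1 * S 1 0 = 1 ->
  torus_continuous f ->
  liouville_measure (fun x => f ((S 0 0)%:~R * x.1 + (S 0 1)%:~R * x.2,
                                 (S 1 0)%:~R * x.1 + (S 1 1)%:~R * x.2)) =
  liouville_measure f.
Proof.
move=> detS tf; apply/eqP; rewrite -subr_eq0 -normr_le0; apply/ler_addgt0Pr => e e0.
rewrite add0r.
have [d d0 fd] := torus_unif_continuous tf e0.
pose n := (Num.truncn d^-1).+1.
have nR : (0 : R) < n%:R by rewrite ltr0n.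
have nd : (n%:R^-1 : R) < d.
  by rewrite invf_plt// truncnS_gt.
have sdet : (S 0 0)%:~R * (S 1 1)%:~R - (S 0 1)%:~R * (S 1 0)%:~R = 1 :> R.
  by rewrite -!intrM -intrB detS.
have sdetM (t : R) :
    ((S 0 0)%:~R * (S 1 1)%:~R - (S 0 1)%:~R * (S 1 0)%:~R) * t = t.
  by rewrite sdet mul1r.
pose J h := liouville_measure (fun x : R * R =>
  h ((S 0 0)%:~R * x.1 + (S 0 1)%:~R * x.2,
     (S 1 0)%:~R * x.1 + (S 1 1)%:~R * x.2)).
have pI := liouville_prob_functional R.
have pJ : prob_functional J.
  have [ID IZ Imon Ic] := pI; split.
  - by move=> g h tg th; apply: ID; exact: torus_continuous_linear.
  - by move=> r g tg; apply: IZ; exact: torus_continuous_linear.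
  - move=> g h tg th gh; apply: Imon; [exact: torus_continuous_linear..|].
    by move=> x; exact: gh.
  - by move=> r; exact: Ic.
apply: (@dist_shift_invariant R J (@liouville_measure R) f
  ((n%:R ^+ 2)^-1 : R, n%:R^-1 : R) (n ^ 2)%N 1 n%:Z n%:R^-1 e) => //.
- move=> h th; rewrite /J.
  (* The vector below is the image of the grid vector (n^-2, n^-1) under the inverse of S, so that S
     carries this translation to the one by the grid vector. *)
  rewrite -[RHS](@liouville_shift_invariant R
    ((S 1 1)%:~R * (n%:R ^+ 2)^-1 - (S 0 1)%:~R * n%:R^-1,
     (S 0 0)%:~R * n%:R^-1 - (S 1 0)%:~R * (n%:R ^+ 2)^-1)); last first.
    exact: torus_continuous_linear.
  congr liouville_measure; apply/funext => -[x y]; congr h; congr pair => /=.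
  + by rewrite -[X in _ + X = _]sdetM; ring.
  + by rewrite -[X in _ + X = _]sdetM; ring.
- exact: liouville_shift_invariant.
- rewrite [LHS]surjective_pairing !raddfMn /=; congr pair.
  + by rewrite -[LHS]mulr_natl natrX mulfV// expf_neq0// gt_eqF.
  + by rewrite -[LHS]mulr_natl natrX expr2 mulfK// gt_eqF.
- exact: orbit_dense_grid.
- move=> x y h1 h2; apply/ltW/fd; exact: lt_trans nd.
Qed.
End SL2_invariance.

(** * Density of the crystal lattices *)

Section Hyperbolic.

(* 4c times the quadratic form is a square minus ((a + d)^2 - 4) y^2, and
   (a + d)^2 - 4 lies strictly between two consecutive squares. *)
Lemma no_integer_eigenvector (a b c d x y : int) :
  a * d - b * c = 1 -> 2 < a + d ->
  x * (c * x + d * y) - y * (a * x + b * y) = 0 -> x = 0 /\ y = 0.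
Proof.
move=> det tr E.
have c0 : c != 0.
  apply/eqP => c0; move: det tr; rewrite c0 mulr0 subr0; clear E => det tr.
  by have [a1|a1] := lerP 1 a; have [d1|d1] := lerP 1 d; nia.
have y0 : y = 0.
  apply/eqP/negPn/negP => y0.
  pose u := 2 * c * x + (d - a) * y.
  have Eu : u ^+ 2 = ((a + d) ^+ 2 - 4) * y ^+ 2.
    rewrite /u; move: det E; rewrite !expr2; nia.
  have : (`|y| ^ 2 %| `|u| ^ 2)%N.
    by rewrite -!abszX; change (y ^+ 2 %| u ^+ 2)%Z; rewrite Eu dvdz_mull.
  rewrite dvdn_pexp2r// => yu.
  have /dvdzP[e Ee] : (y %| u)%Z by rewrite dvdzE.
  have e2 : e ^+ 2 = (a + d) ^+ 2 - 4.
    apply: (mulIf (x := y ^+ 2)); first by rewrite expf_neq0.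
    by rewrite -Eu Ee exprMn.
  move: e2 tr; rewrite !expr2; clear; move: (a + d) => t.
  have : `|e| * `|e| = e * e :> int by rewrite -normrM ger0_norm// -expr2 sqr_ge0.
  move: (normr_ge0 e); move: `|e| => f f0 <- E1 t2.
  have ft : f < t by nia.
  have : f * f <= (t - 1) * (t - 1) by apply: ler_pM => //; lia.
  by rewrite E1; nia.
split=> //; move: E; rewrite y0 !mulr0 !mul0r addr0 subr0.
by move/eqP; rewrite !mulf_eq0 (negbTE c0)/= orbb => /eqP.
Qed.

Lemma dist_nat_lt (m1 m2 g : nat) : (m1 < g)%N -> (m2 < g)%N ->
  `|m2%:Z - m1%:Z| < g%:Z.
Proof. by move=> h1 h2; rewrite ltr_norml; apply/andP; split; lia. Qed.

(** The g multiples of (k', k), reduced modulo g, fall into n^2 < g boxes of side g/n, and the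
    vector is the difference of two of them in one box. It is nonzero by Bezout: if g divided d k'
    and d k it would divide d, whereas d is a difference of two distinct indices below g. *)
Lemma short_multiple (g n : nat) (k' k : int) : (n ^ 2 < g)%N -> (0 < n)%N ->
  coprimez k' k -> exists d x y : int,
  [/\ (x != 0) || (y != 0), n%:Z * `|x| < g%:Z, n%:Z * `|y| < g%:Z,
      (g %| x - d * k')%Z & (g %| y - d * k)%Z].
Proof.
move=> ng n0 cop.
have g0 : (0 < g)%N by exact: leq_ltn_trans ng.
have gz : g%:Z != 0 :> int by rewrite -lt0n.
pose r (t : int) (i : 'I_g) : nat := `|modz (i%:Z * t) g%:Z|%N.
have rE t i : (r t i)%:Z = modz (i%:Z * t) g%:Z by rewrite /r gez0_abs// modz_ge0.
have rg t i : (r t i < g)%N by rewrite -ltz_nat rE ltz_pmod.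
have rn t i : (n * r t i %/ g < n)%N by rewrite ltn_divLR// ltn_pmul2l.
pose F (i : 'I_g) : 'I_n * 'I_n := (Ordinal (rn k' i), Ordinal (rn k i)).
have : ~~ injectiveb F.
  apply/negP => /injectiveP /leq_card; rewrite card_prod !card_ord.
  by rewrite leqNgt mulnn ng.
case/injectivePn => i [i' ii' [/= e1 e2]].
have close t : (n * r t i %/ g = n * r t i' %/ g)%N ->
    n%:Z * `|(r t i)%:Z - (r t i')%:Z| < g%:Z.
  move=> e; have := divn_eq (n * r t i) g; have := divn_eq (n * r t i') g.
  have := ltn_pmod (n * r t i) g0; have := ltn_pmod (n * r t i') g0.
  rewrite e; move: (n * r t i' %/ g)%N (n * r t i' %% g)%N (n * r t i %% g)%N.
  move: (r t i) (r t i') => r1 r2 q m1 m2 h1 h2 h3 h4.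
  have : n%:Z * (r1%:Z - r2%:Z) = m2%:Z - m1%:Z by rewrite mulrBr -!PoszM h4 h3; lia.
  have -> : n%:Z * `|r1%:Z - r2%:Z| = `|n%:Z * (r1%:Z - r2%:Z)|.
    by rewrite normrM [`|n%:Z|]ger0_norm.
  by move=> ->; exact: dist_nat_lt.
have cong t : (g %| (r t i)%:Z - (r t i')%:Z - (i%:Z - i'%:Z) * t)%Z.
  by rewrite !rE /modz; apply/dvdzP; exists
    (- divz (i%:Z * t) g%:Z + divz (i'%:Z * t) g%:Z); ring.
exists (i%:Z - i'%:Z), ((r k' i)%:Z - (r k' i')%:Z), ((r k i)%:Z - (r k i')%:Z).
split; [|exact: close|exact: close|exact: cong|exact: cong].
rewrite -negb_and; apply/negP => /andP[/eqP z1 /eqP z2].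
have := cong k'; have := cong k; rewrite z1 z2 !sub0r !rpredN => h1 h2.
have : (g %| i%:Z - i'%:Z)%Z.
  have [u [v uv]] := Bezoutz k' k.
  move: uv; rewrite (eqP cop) => uv.
  rewrite -[X in (_ %| X)%Z]mulr1 -uv mulrDr !(mulrCA (_ - _)).
  by rewrite rpredD// dvdz_mull.
rewrite -eqz_mod_dvd !modz_nat !modn_small// => /eqP[] ie.
by move: ii'; rewrite (val_inj ie : i = i') eqxx.
Qed.

Lemma frac_norm_le1 (R : realType) (t : R) : `|t - (Num.floor t)%:~R| <= 1.
Proof.
have /andP[] := floor_itv t; rewrite intrD => h1 h2.
by rewrite ger0_norm ?subr_ge0//; lra.
Qed.

(** With X a short multiple of (k', k) modulo g, the target g t is expanded in the basis X, S X and
    its coordinates are rounded down; the error is at most the size of one cell. The threshold [g0]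
    is chosen before k', k and lam, because only the lengths of X and S X enter the estimate. *)
Lemma orbit_dense_hyperbolic (R : realType) (a b c d : int) (e : R) :
  a * d - b * c = 1 -> 2 < a + d -> 0 < e ->
  exists g0 : nat, forall (g : nat) (k' k lam : int), (g0 <= g)%N ->
    coprimez k' k ->
    (g %| a * k' + b * k - lam * k')%Z -> (g %| c * k' + d * k - lam * k)%Z ->
    orbit_dense (k'%:~R / g%:R : R, k%:~R / g%:R : R) e.
Proof.
move=> det tr e0.
(* [M] bounds, up to the factor g/n, the extent of a cell in each coordinate: a row of S accounts
   for S X and the summand 1 for X. The choice of [n] then makes M/n smaller than e. *)
pose M : int := `|a| + `|b| + `|c| + `|d| + 1.
have M0 : 0 < M by rewrite /M ltr_wpDl// !addr_ge0.
have Mab : `|a| + `|b| + 1 <= M.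
  by have := normr_ge0 c; have := normr_ge0 d; rewrite /M; lia.
have Mcd : `|c| + `|d| + 1 <= M.
  by have := normr_ge0 a; have := normr_ge0 b; rewrite /M; lia.
pose n := (Num.truncn (M%:~R / e)).+1.
have ne : M%:~R / e < n%:R by rewrite truncnS_gt.
exists (n ^ 2).+1 => g k' k lam ng cop dv1 dv2 [t1 t2].
have n0 : (0 < n)%N by [].
have g0 : (0 < g)%N by exact: leq_ltn_trans ng.
have gR : (0 : R) < g%:R by rewrite ltr0n.
have nR : (0 : R) < n%:R by rewrite ltr0n.
have [m [x [y [xy0 nx ny dvx dvy]]]] := short_multiple ng n0 cop.
pose x' := a * x + b * y; pose y' := c * x + d * y.
have D0 : x * y' - y * x' != 0.
  apply/eqP => /(no_integer_eigenvector det tr)[x0 y0].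
  by move: xy0; rewrite x0 y0 eqxx.
pose D : R := (x * y' - y * x')%:~R.
have DR : D != 0 by rewrite intr_eq0.
have DE : D = x%:~R * y'%:~R - y%:~R * x'%:~R by rewrite /D intrB !intrM.
(* Cramer's rule for g t = al X + be S X. *)
pose al := g%:R * (t1 * y'%:~R - t2 * x'%:~R) / D.
pose be := g%:R * (x%:~R * t2 - y%:~R * t1) / D.
pose A := Num.floor al; pose B := Num.floor be.
have E1 : al * x%:~R + be * x'%:~R = g%:R * t1.
  by rewrite /al /be; move: DR; rewrite DE => DR; field.
have E2 : al * y%:~R + be * y'%:~R = g%:R * t2.
  by rewrite /al /be; move: DR; rewrite DE => DR; field.
have gz : g%:Z != 0 :> int by rewrite -lt0n.
(* The lattice point A X + B S X is a multiple of (k', k) modulo g, since X is m (k', k) and S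
   multiplies (k', k) by lam; this is the index of that multiple. *)
pose n1 := modz (A * m + B * lam * m) g%:Z.
have n1E : (`|n1|%N)%:Z = n1 by rewrite gez0_abs// modz_ge0.
have dvn1 : (g %| A * m + B * lam * m - n1)%Z.
  by rewrite /n1 /modz opprB addrCA subrr addr0 dvdz_mull.
have dv1' : (g %| A * x + B * x' - n1 * k')%Z.
  have -> : A * x + B * x' - n1 * k' = (A + B * a) * (x - m * k') +
      (B * b) * (y - m * k) + (B * m) * (a * k' + b * k - lam * k') +
      k' * (A * m + B * lam * m - n1) by rewrite /x'; ring.
  by rewrite !rpredD// dvdz_mull.
have dv2' : (g %| A * y + B * y' - n1 * k)%Z.
  have -> : A * y + B * y' - n1 * k = (A + B * d) * (y - m * k) +
      (B * c) * (x - m * k') + (B * m) * (c * k' + d * k - lam * k) +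
      k * (A * m + B * lam * m - n1) by rewrite /y'; ring.
  by rewrite !rpredD// dvdz_mull.
have [K1 EK1] := dvdzP dv1'; have [K2 EK2] := dvdzP dv2'.
exists `|n1|%N, K1, K2.
have close (s : R) (u u' v K : int) : n%:Z * (`|u| + `|u'|) <= M * g%:Z ->
    al * u%:~R + be * u'%:~R = g%:R * s ->
    A * u + B * u' - n1 * v = K * g%:Z ->
    `|(absz n1)%:R * (v%:~R / g%:R) + K%:~R - s| < e.
  move=> small Es EK.
  have -> : (absz n1)%:R = n1%:~R :> R by rewrite -[in RHS]n1E.
  have {}EK : A%:~R * u%:~R + B%:~R * u'%:~R - n1%:~R * v%:~R = K%:~R * g%:R :> R.
    by rewrite -!intrM -intrD -intrB EK intrM.
  have -> : n1%:~R * (v%:~R / g%:R) + K%:~R - s =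
      - ((al - A%:~R) * u%:~R + (be - B%:~R) * u'%:~R) / g%:R.
    apply: (mulIf (lt0r_neq0 gR)); rewrite mulfVK ?lt0r_neq0//.
    rewrite mulrBl mulrDl -EK mulrA mulfVK ?lt0r_neq0// (mulrC s) -Es; ring.
  rewrite normrM normfV normrN (gtr0_norm gR) ltr_pdivrMr//.
  have {}small : n%:R * (`|u%:~R| + `|u'%:~R|) <= M%:~R * g%:R :> R.
    by move: small; rewrite -(ler_int R) !intrM intrD !intr_norm.
  have sm : `|(al - A%:~R) * u%:~R + (be - B%:~R) * u'%:~R| <=
      `|u%:~R| + `|u'%:~R| :> R.
    rewrite (le_trans (ler_normD _ _))// !normrM lerD// ler_piMl//.
    - exact: frac_norm_le1.
    - exact: frac_norm_le1.
  rewrite (le_lt_trans sm)// -(ltr_pM2l nR) (le_lt_trans small)//.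
  by rewrite mulrA ltr_pM2r// -ltr_pdivrMr.
have bound (p q : int) : `|p| + `|q| + 1 <= M ->
   forall u, n%:Z * `|u| < g%:Z ->
   n%:Z * (`|u| + `|p * x + q * y|) <= M * g%:Z.
  move=> pq u nu.
  have h : `|p * x + q * y| <= `|p| * `|x| + `|q| * `|y|.
    by rewrite (le_trans (ler_normD _ _))// !normrM.
  rewrite mulrDr (le_trans (y := g%:Z + (`|p| + `|q|) * g%:Z))//; last first.
    by rewrite -{1}[g%:Z]mul1r -mulrDl ler_pM2r ?ltz_nat// addrC.
  rewrite lerD ?(ltW nu)// (le_trans (ler_wpM2l _ h))//.
  rewrite mulrDr mulrDl lerD// mulrCA ler_wpM2l// ltW//.
split => /=.
- by apply: (close _ _ _ _ _ _ E1 EK1); exact: bound.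
- by apply: (close _ _ _ _ _ _ E2 EK2); exact: bound.
Qed.
End Hyperbolic.

(** * The equidistribution criterion *)

Section Equidistribution.
Variable R : realType.

(** The integers k', k and lam may depend on N without any control, because the density of the
    lattice is uniform in them. The functional is left abstract in order to serve for the Husimi
    measures and for the zeros. *)
Lemma crystal_equidistribution (S : 'M[int]_2) (A : set nat) (gam : nat -> nat)
    (J : nat -> (R * R -> R) -> R) :
  S 0 0 * S 1 1 - S 0 1 * S 1 0 = 1 -> 2 < S 0 0 + S 1 1 ->
  gam N @[N --> within A \oo] --> \oo ->
  (forall N, A N -> prob_functional (J N) /\ exists k' k lam : int,
    [/\ coprimez k' k,
        (gam N %| (S 0 0 * k' + S 0 1 * k - lam * k')%R)%Z,
        (gam N %| (S 1 0 * k' + S 1 1 * k - lam * k)%R)%Z &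
        shift_invariant (J N) (k'%:~R / (gam N)%:R, k%:~R / (gam N)%:R)]) ->
  weak_star_cvg A J (@liouville_measure R).
Proof.
move=> det tr gamoo HJ f tf; apply/cvgrPdist_le => e e0.
have [d d0 fd] := torus_unif_continuous tf e0.
have [g0 dense] := orbit_dense_hyperbolic det tr d0.
have big : \forall N \near within A \oo, (g0.+1 <= gam N)%N.
  exact: (gamoo _ (nbhs_infty_ge g0.+1)).
have inA : \forall N \near within A \oo, A N.
  by rewrite near_withinE; exact: nearW.
near=> N.
have AN : A N by near: N.
have gN : (g0 < gam N)%N by near: N.
have [pJ [k' [k [lam [cop dv1 dv2 inv]]]]] := HJ N AN.
rewrite distrC.
apply: (@dist_shift_invariant R (J N) (@liouville_measure R) f _ (gam N) k' k d e pJ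
  (liouville_prob_functional R) inv) => //.
- exact: liouville_shift_invariant.
- exact: leq_ltn_trans gN.
- have g1 : ((gam N)%:R : R) != 0 by rewrite pnatr_eq0 -lt0n (leq_ltn_trans _ gN).
  rewrite [LHS]surjective_pairing !raddfMn /=; congr pair;
    by rewrite -[LHS]mulr_natl mulrC mulfVK.
- by apply: (dense _ _ _ lam) => //; exact: ltnW.
- by move=> x y h1 h2; apply/ltW/fd.
Unshelve. all: by end_near.
Qed.
End Equidistribution.

(** * Zero patterns *)

Section Zeros.
Variable R : realType.
Notation C := R[i].
Import ComplexField.Normc.

Lemma Re_sqr_norm (z : C) : complex.Re (`|z| ^+ 2) = normc z ^+ 2.
Proof. by rewrite -[`|z|]/((normc z)%:C) -rmorphXn. Qed.

Lemma normcX (z : C) n : normc (z ^+ n) = normc z ^+ n.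
Proof. by elim: n => [|n IH]; rewrite ?normc1// !exprS normcM IH. Qed.

Lemma normc_ge0 (z : C) : 0 <= normc z.
Proof. by case: z => a b; exact: sqrtr_ge0. Qed.

Lemma normc_real (t : R) : normc (t%:C) = `|t|.
Proof. by rewrite /= expr0n /= addr0 sqrtr_sqr. Qed.

Lemma entire_near (g : C^o -> C^o) (z : C) (e : R) :
  (forall z : C^o, derivable g z 1) -> 0 < e ->
  exists2 d : R, 0 < d & forall s : R, `|s| < d -> normc (g (z + s%:C) - g z) < e.
Proof.
move=> dg e0.
have cg : continuous_at (z : C^o) g.
  by apply: differentiable_continuous; apply/derivable1_diffP; exact: dg.
have e0C : 0 < e%:C :> C by rewrite ltcR.
have /cvgrPdist_lt/(_ _ e0C) Hz := cg.
have /(@nbhs_ballP C C^o)[d /= d0 Hd] :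
  nbhs (z : C^o) (fun t => `|g z - g t| < e%:C) by exact: Hz.
have dR : d = (complex.Re d)%:C by rewrite RRe_real// ger0_real// ltW.
have d0' : 0 < complex.Re d by rewrite dR ltcR in d0.
exists (complex.Re d) => // s sd.
have : `|g z - g (z + s%:C)| < e%:C.
  apply: Hd; rewrite /ball /= opprD addNKr normrN normc_def /= expr0n /= addr0.
  by rewrite sqrtr_sqr dR ltcR.
by rewrite distrC -[ltLHS](RRe_real (normr_real _)) ltcR.
Qed.

(* The order of a zero is read off from the decay of the Husimi density along
   the horizontal direction. *)
Lemma husimi_zero_order N (f : C -> C) (x x' : R * R) (n m : nat) :
  (forall t, husimi N f (x + t) = husimi N f (x' + t)) ->
  zero_order f (phase_pt x) n -> zero_order f (phase_pt x') m -> (m <= n)%N.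
Proof.
move=> H [g [dg g0 fg]] [h [dh h0 fh]]; rewrite leqNgt; apply/negP => nm.
pose E (y : R * R) : R := 2 * pi * N%:R * normc (phase_pt y) ^+ 2.
have sq2 : (0 : R) < Num.sqrt 2 by rewrite sqrtr_gt0.
have Hf (y : R * R) (q : C^o -> C^o) (k : nat) (t : R) : 0 < t ->
    (forall w, f w = (w - phase_pt y) ^+ k * q w) ->
    husimi N f (y + (Num.sqrt 2 * t, 0)) =
    (t ^+ k * normc (q (phase_pt y + t%:C))) ^+ 2 *
    expR (- E (y + (Num.sqrt 2 * t, 0))).
  move=> t0 fq.
  have pE : phase_pt (y + (Num.sqrt 2 * t, 0)) = phase_pt y + t%:C.
    apply/eqP; rewrite eq_complex /= !addr0 eqxx andbT mulrDl.
    by rewrite [_ * t]mulrC mulfK// lt0r_neq0.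
  rewrite /husimi /E !Re_sqr_norm; congr (_ ^+ 2 * _).
  by rewrite pE fq addrAC subrr add0r normcM normcX normc_real gtr0_norm.
pose a := normc (g (phase_pt x)).
have a0 : 0 < a by rewrite lt_def normc_ge0 andbT; apply: contra g0 => /eqP/eq0_normc ->.
have [d1 d10 near1] := entire_near (phase_pt x) dg (divr_gt0 a0 (ltr0Sn R 1)).
have [d2 d20 near2] := entire_near (phase_pt x') dh ltr01.
pose b := normc (h (phase_pt x')) + 1.
have b0 : 0 < b by rewrite ltr_wpDl// normc_ge0.
pose K := 2 * pi * N%:R * (normc (phase_pt x) + 1) ^+ 2.
pose c := (a / 2) ^+ 2 * expR (- K).
have c0 : 0 < c by rewrite mulr_gt0 ?expR_gt0// exprn_gt0// divr_gt0.
(* If n < m, the density near x is at least t^(2n) c and the one near x' at most t^(2n) t b^2. The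
   first two bounds on t control g and h by continuity, the third gives t < 1, and the last gives t
   b^2 < c, a contradiction. *)
pose t := Num.min (Num.min (d1 / 2) (d2 / 2)) (Num.min (1 / 2) (c / (2 * b ^+ 2))).
have t0 : 0 < t by rewrite !lt_min !divr_gt0// mulr_gt0// exprn_gt0.
have td1 : `|t| < d1.
  by rewrite gtr0_norm// (le_lt_trans (y := d1 / 2))// ?ge_min ?lexx//; lra.
have td2 : `|t| < d2.
  by rewrite gtr0_norm// (le_lt_trans (y := d2 / 2))// ?ge_min ?lexx ?orbT//; lra.
have t1 : t < 1.
  by rewrite (le_lt_trans (y := 1 / 2))// ?ge_min ?lexx ?orbT//; lra.
have tb : t * b ^+ 2 < c.
  rewrite (le_lt_trans (y := c / 2))//; last lra.
  have -> : c / 2 = c / (2 * b ^+ 2) * b ^+ 2 by field; rewrite gt_eqF.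
  by rewrite ler_wpM2r ?exprn_ge0 ?(ltW b0)// !ge_min lexx !orbT.
have := H (Num.sqrt 2 * t, 0).
rewrite (Hf x g n t t0 fg) (Hf x' h m t t0 fh); apply/eqP; rewrite gt_eqF//.
have hb : normc (h (phase_pt x' + t%:C)) <= b.
  have -> : h (phase_pt x' + t%:C) =
    (h (phase_pt x' + t%:C) - h (phase_pt x')) + h (phase_pt x') by rewrite subrK.
  by rewrite (le_trans (le_normcD _ _))// addrC lerD2l ltW// near2.
have ga : a / 2 <= normc (g (phase_pt x + t%:C)).
  rewrite -(lerD2r (a / 2)) -splitr.
  have aE : a = normc (g (phase_pt x + t%:C) - (g (phase_pt x + t%:C) - g (phase_pt x))).
    by rewrite opprB addrC subrK.
  by rewrite [leLHS]aE (le_trans (le_normcD _ _))// normcN lerD2l ltW// near1.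
have EK : E (x + (Num.sqrt 2 * t, 0)) <= K.
  rewrite /E /K ler_wpM2l ?mulr_ge0 ?pi_ge0// lerXn2r ?nnegrE ?addr_ge0 ?normc_ge0//.
  have -> : phase_pt (x + (Num.sqrt 2 * t, 0)) = phase_pt x + t%:C.
    apply/eqP; rewrite eq_complex /= !addr0 eqxx andbT mulrDl.
    by rewrite [_ * t]mulrC mulfK// lt0r_neq0.
  by rewrite (le_trans (le_normcD _ _))// lerD2l normc_real gtr0_norm// ltW.
have E0 : 0 <= E (x' + (Num.sqrt 2 * t, 0)).
  by rewrite /E mulr_ge0 ?sqr_ge0// mulr_ge0// mulr_ge0// pi_ge0.
have tn0 : 0 < t ^+ n by rewrite exprn_gt0.
apply: (@lt_le_trans _ _ ((t ^+ n) ^+ 2 * c)); last first.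
  rewrite exprMn /c mulrA; apply: ler_pM.
  - by rewrite -exprMn sqr_ge0.
  - exact: expR_ge0.
  - by rewrite ler_wpM2l ?sqr_ge0// lerXn2r ?nnegrE ?normc_ge0 ?divr_ge0 ?(ltW a0).
  - by rewrite ler_expR lerN2.
apply: (@le_lt_trans _ _ ((t ^+ n) ^+ 2 * (t * b ^+ 2))); last first.
  by rewrite ltr_pM2l// exprn_gt0.
rewrite -[leRHS]mulr1; apply: ler_pM; [exact: sqr_ge0|exact: expR_ge0| |]; last first.
  by rewrite -[leRHS]expR0 ler_expR oppr_le0.
rewrite exprMn mulrA; apply: ler_pM; [exact: sqr_ge0|exact: sqr_ge0| |]; last first.
  by rewrite lerXn2r ?nnegrE ?normc_ge0 ?(ltW b0).
rewrite (@le_trans _ _ ((t ^+ n.+1) ^+ 2))//.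
  by rewrite lerXn2r ?nnegrE ?exprn_ge0 ?(ltW t0)// ler_wiXn2l ?(ltW t0) ?(ltW t1).
rewrite (exprSr t n) exprMn ler_wpM2l ?sqr_ge0// expr2 -[leRHS]mulr1.
by rewrite ler_wpM2l ?(ltW t0)// ltW.
Qed.

Definition frac_pt (x : R * R) : R * R :=
  (x.1 - (Num.floor x.1)%:~R, x.2 - (Num.floor x.2)%:~R).

Lemma frac_pt_torus x : torus_pt (frac_pt x).
Proof.
have aux (t : R) : 0 <= t - (Num.floor t)%:~R < 1.
  by have /andP[] := floor_itv t; rewrite intrD => h1 h2; apply/andP; split; lra.
by rewrite /torus_pt !aux.
Qed.

Lemma frac_ptE x : exists k l : int, frac_pt x = x + (k%:~R, l%:~R).
Proof.
by exists (- Num.floor x.1), (- Num.floor x.2); rewrite /frac_pt !mulrNz.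
Qed.

Lemma torus_pt_uniq (x y : R * R) (k l : int) : torus_pt x -> torus_pt y ->
  x = y + (k%:~R, l%:~R) -> x = y.
Proof.
have aux (s t : R) (i : int) : 0 <= s < 1 -> 0 <= t < 1 -> s = t + i%:~R -> s = t.
  move=> /andP[s0 s1] /andP[t0 t1] E.
  have h1 : (i%:~R : R) < 1%:~R by rewrite /=; lra.
  have h2 : ((-1)%:~R : R) < i%:~R by rewrite /=; lra.
  have i0 : i = 0 by move: h1 h2; rewrite !ltr_int; lia.
  by rewrite E i0 addr0.
case: x y => [x1 x2] [y1 y2] /andP[/= a b] /andP[/= c d] [E1 E2].
by congr pair; [exact: aux E1|exact: aux E2].
Qed.

(** Only the density is assumed invariant, not the function [f]. Around a point and around its
    translate by -w the densities coincide, so [husimi_zero_order], used in both directions, equates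
    the two multiplicities; the zeros and their reduced translates are then permutations of each
    other. *)
Lemma atomic_shift_invariant N (f : C -> C) (pts : 'I_N -> R * R) (w : R * R) :
  (forall x (k l : int), husimi N f (x + (k%:~R, l%:~R)) = husimi N f x) ->
  (forall x, husimi N f (x + w) = husimi N f x) ->
  zeros_list f pts -> shift_invariant (atomic_measure pts) w.
Proof.
move=> Hper Hw [tpts zpts] F tF; rewrite /atomic_measure; congr (_ * _).
pose q k := frac_pt (pts k + w).
have card_eq (x : R * R) : torus_pt x ->
    #|[set k | q k == x]%SET| = #|[set k | pts k == x]%SET|.
  move=> tx; pose x' := frac_pt (x - w).
  have [k [l x'E]] := frac_ptE (x - w).
  have -> : [set k | q k == x]%SET = [set k | pts k == x']%SET.
    apply/setP => i; rewrite !inE.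
    have [k1 [l1 qE]] := frac_ptE (pts i + w).
    apply/eqP/eqP => E.
    - apply: (@torus_pt_uniq _ _ (- k1 - k) (- l1 - l)).
      + exact: tpts.
      + exact: frac_pt_torus.
      + rewrite /x' x'E -E /q qE; apply: injective_projections => /=; rewrite !intrB !mulrNz; ring.
    - apply: (@torus_pt_uniq _ _ (k1 + k) (l1 + l)) => //.
      + exact: frac_pt_torus.
      + rewrite /q qE E /x' x'E; apply: injective_projections => /=; rewrite !intrD; ring.
  have tx' : torus_pt x' by exact: frac_pt_torus.
  have Hxx' t : husimi N f (x' + t) = husimi N f (x + t).
    rewrite -(Hw (x' + t)) -(Hper (x + t) k l); congr husimi; rewrite /x' x'E.
    by apply: injective_projections => /=; ring.
  by apply/eqP; rewrite eqn_leq; apply/andP; split;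
    apply: husimi_zero_order (zpts _ _) (zpts _ _).
have -> : \sum_(k < N) F (pts k + w) = \sum_(x <- [seq q k | k : 'I_N]) F x.
  rewrite big_image /=; apply: eq_bigr => k _.
  rewrite /q; have [k1 [l1 ->]] := frac_ptE (pts k + w).
  by rewrite torus_periodic.
have -> : \sum_(k < N) F (pts k) = \sum_(x <- [seq pts k | k : 'I_N]) F x.
  by rewrite big_image.
apply: perm_big; apply/allP => x _ /=.
have cnt (u : 'I_N -> R * R) : count_mem x [seq u k | k : 'I_N] = #|[set k | u k == x]%SET|.
  rewrite count_map -sum1_count big_enum_cond /= -sum1_card.
  by apply: eq_bigl => i; rewrite inE.
(* Outside the fundamental square both multiplicities are 0, as all the listed points lie in it. *)
rewrite !cnt; have [tx|ntx] := pselect (torus_pt x); first by rewrite card_eq.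
suff no (u : 'I_N -> R * R) : (forall k, torus_pt (u k)) -> #|[set k | u k == x]%SET| = 0%N.
  by rewrite !no// => k; exact: frac_pt_torus.
move=> tu; apply/eqP; rewrite cards_eq0; apply/eqP/setP => i; rewrite !inE.
by apply/eqP => E; apply: ntx; rewrite -E.
Qed.

Lemma atomic_prob_functional N (pts : 'I_N -> R * R) : (0 < N)%N ->
  prob_functional (atomic_measure pts).
Proof.
move=> N0; have N0' : (N%:R : R) != 0 by rewrite pnatr_eq0 -lt0n.
rewrite /atomic_measure; split.
- by move=> F G _ _; rewrite big_split mulrDr.
- by move=> r F _; rewrite -mulr_sumr mulrCA.
- by move=> F G _ _ FG; rewrite ler_wpM2l ?invr_ge0// ler_sum.
- by move=> r; rewrite sumr_const card_ord -[r *+ N]mulr_natl mulKf.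
Qed.
End Zeros.

(** * Bilateral series and theta functions *)

Section Complex_exponential.
Variable R : realType.
Notation C := R[i].
Import ComplexField.Normc.
Implicit Types z w : C.

Lemma normc_sqr z : normc z ^+ 2 = complex.Re z ^+ 2 + complex.Im z ^+ 2.
Proof. by case: z => a b; rewrite /= sqr_sqrtr// addr_ge0 ?sqr_ge0. Qed.

Lemma ReM z w : complex.Re (z * w) = complex.Re z * complex.Re w - complex.Im z * complex.Im w.
Proof. by case: z; case: w. Qed.

Lemma ImM z w : complex.Im (z * w) = complex.Re z * complex.Im w + complex.Im z * complex.Re w.
Proof. by case: z; case: w. Qed.

Lemma ReD z w : complex.Re (z + w) = complex.Re z + complex.Re w.
Proof. by case: z; case: w. Qed.

Lemma ImD z w : complex.Im (z + w) = complex.Im z + complex.Im w.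
Proof. by case: z; case: w. Qed.

Lemma ReN z : complex.Re (- z) = - complex.Re z. Proof. by case: z. Qed.
Lemma ImN z : complex.Im (- z) = - complex.Im z. Proof. by case: z. Qed.

Lemma Re_sum (I : Type) (r : seq I) (F : I -> C) :
  complex.Re (\sum_(i <- r) F i) = \sum_(i <- r) complex.Re (F i).
Proof. by elim/big_rec2: _ => [//|i x y _ <-]; rewrite ReD. Qed.

Lemma Im_sum (I : Type) (r : seq I) (F : I -> C) :
  complex.Im (\sum_(i <- r) F i) = \sum_(i <- r) complex.Im (F i).
Proof. by elim/big_rec2: _ => [//|i x y _ <-]; rewrite ImD. Qed.

Lemma normc_Re z : `|complex.Re z| <= normc z.
Proof.
rewrite -[leRHS]ger0_norm ?normc_ge0// -ler_sqr ?nnegrE//.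
by rewrite !real_normK ?num_real// normc_sqr lerDl sqr_ge0.
Qed.

Lemma normc_Im z : `|complex.Im z| <= normc z.
Proof.
rewrite -[leRHS]ger0_norm ?normc_ge0// -ler_sqr ?nnegrE//.
by rewrite !real_normK ?num_real// normc_sqr lerDr sqr_ge0.
Qed.

Lemma le_normc_ReIm z : normc z <= `|complex.Re z| + `|complex.Im z|.
Proof.
rewrite -[leLHS]ger0_norm ?normc_ge0// -[leRHS]ger0_norm ?addr_ge0//.
rewrite -ler_sqr ?nnegrE// !real_normK ?num_real// normc_sqr sqrrD.
by rewrite !real_normK ?num_real// -addrA addrCA lerDr mulrn_wge0// mulr_ge0.
Qed.

Lemma normc_sum (I : Type) (r : seq I) (F : I -> C) :
  normc (\sum_(i <- r) F i) <= \sum_(i <- r) normc (F i).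
Proof.
elim/big_rec2: _ => [|i x y _ h]; first by rewrite normc0.
by rewrite (le_trans (le_normcD _ _))// lerD2l.
Qed.

Lemma cexpD z w : cexp (z + w) = cexp z * cexp w.
Proof.
case: z => a b; case: w => c d; apply/eqP; rewrite eq_complex /cexp /=.
by rewrite expRD cosD sinD; apply/andP; split; apply/eqP; ring.
Qed.

Lemma normc_cexp z : normc (cexp z) = expR (complex.Re z).
Proof.
case: z => a b; rewrite /= !exprMn -mulrDr cos2Dsin2 mulr1 sqrtr_sqr.
by rewrite ger0_norm// expR_ge0.
Qed.

Lemma e2piE (t : R) : e2pi t = cexp (0 +i* (2 * pi * t)).
Proof. by rewrite /e2pi /cexp /= expR0 !mul1r. Qed.

Lemma e2piD (s t : R) : e2pi (s + t) = e2pi s * e2pi t.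
Proof. by rewrite !e2piE -cexpD; congr cexp; apply/eqP; rewrite eq_complex /= addr0 mulrDr !eqxx. Qed.

Lemma normc_e2pi (t : R) : normc (e2pi t) = 1.
Proof. by rewrite e2piE normc_cexp expR0. Qed.

Lemma e2pi0 : e2pi (0 : R) = 1.
Proof. by rewrite /e2pi mulr0 cos0 sin0. Qed.

Lemma e2pi_half : e2pi (1 / 2 : R) = -1.
Proof.
have -> : (1 / 2 : R) = 2^-1 by rewrite mul1r.
rewrite /e2pi mulrAC divff// mul1r cospi sinpi.
by apply/eqP; rewrite eq_complex /= oppr0 !eqxx.
Qed.

Lemma e2pi1 : e2pi (1 : R) = 1.
Proof. by rewrite [X in e2pi X](splitr 1) e2piD e2pi_half mulrNN mulr1. Qed.

Lemma e2pi_int (n : int) : e2pi (n%:~R : R) = 1.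
Proof.
have en (k : nat) : e2pi (k%:R : R) = 1.
  by elim: k => [|k IH]; rewrite ?e2pi0// -natr1 e2piD IH e2pi1 mulr1.
case: n => n; first exact: en.
rewrite NegzE mulrNz; have := e2piD (n.+1%:R : R) (- n.+1%:R).
by rewrite subrr e2pi0 en mul1r.
Qed.

Lemma normc_signz (m : int) : normc ((-1) ^ m : C) = 1.
Proof.
have n1 : normc (-1 : C) = 1 by rewrite normcN normc1.
case: m => n; first by rewrite -exprnP normcX n1 expr1n.
by rewrite NegzE -exprnN normcV normcX n1 expr1n invr1.
Qed.
End Complex_exponential.

(** * Bilateral series with a geometric majorant *)

Section Bilateral_sums.
Variable R : realType.
Notation C := R[i].
Import ComplexField.Normc.
Implicit Types (F : int -> C) (B r : R).

Definition psum F n : C := \sum_(k < n.*2.+1) F (k%:Z - n%:Z).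

Definition has_sumZ F (z : C) :=
  (complex.Re (psum F n) @[n --> \oo] --> complex.Re z) /\
  (complex.Im (psum F n) @[n --> \oo] --> complex.Im z).

(** Weaker than the Gaussian decay of the theta terms, but with explicit tails whose constants can
    be kept uniform in the point. *)
Definition geom_dominated F B r := forall m, normc (F m) <= B * r ^+ `|m|%N.

Lemma has_sumZE F z : has_sumZ F z -> sumZ F = z.
Proof.
move=> [hR hI]; rewrite /sumZ; case: z hR hI => a b /= hR hI.
by congr (_ +i* _); apply: cvg_lim.
Qed.

Lemma psumS F n : psum F n.+1 = F (- n.+1%:Z) + psum F n + F n.+1%:Z.
Proof.
rewrite /psum doubleS big_ord_recl big_ord_recr /= addrA; congr (_ + _ + _).
- by congr F; rewrite sub0r.
- by apply: eq_bigr => k _; congr F; rewrite /bump /=; lia.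
- by congr F; rewrite /bump /=; lia.
Qed.

Lemma psum_shift F n :
  psum (fun m => F (m + 1)) n = psum F n - F (- n%:Z) + F n.+1%:Z.
Proof.
rewrite /psum big_ord_recr [in RHS]big_ord_recl /= sub0r [F _ + _]addrC addrK.
congr (_ + _); last by congr F; lia.
by apply: eq_bigr => k _; congr F; rewrite /bump /=; lia.
Qed.

Lemma psum_dist F B r n k : 0 <= r < 1 -> geom_dominated F B r ->
  normc (psum F (n + k) - psum F n) <= 2 * B * r ^+ n / (1 - r).
Proof.
move=> /andP[r0 r1] dF.
have B0 : 0 <= B.
  by have := dF 0; rewrite expr0 mulr1; apply: le_trans; exact: normc_ge0.
have q0 : 0 < 1 - r by lra.
(* The exact value of the finite geometric sum is what makes the induction on k close. *)
have step : normc (psum F (n + k) - psum F n) <=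
    2 * B * (r ^+ n.+1 - r ^+ (n + k).+1) / (1 - r).
  elim: k => [|k IH]; first by rewrite addn0 !subrr mulr0 mul0r normc0.
  rewrite addnS psumS.
  have -> : F (- (n + k).+1%:Z) + psum F (n + k) + F (n + k).+1 - psum F n =
    (psum F (n + k) - psum F n) + (F (- (n + k).+1%:Z) + F (n + k).+1) by ring.
  rewrite (le_trans (le_normcD _ _))//.
  have h : normc (F (- (n + k).+1%:Z) + F (n + k).+1) <= 2 * B * r ^+ (n + k).+1.
    rewrite (le_trans (le_normcD _ _))//.
    have := dF (- (n + k).+1%:Z); have := dF (n + k).+1%:Z.
    rewrite abszN absz_nat; lra.
  rewrite (le_trans (lerD IH h))// [r ^+ (n + k).+2]exprS.
  by rewrite le_eqVlt; apply/orP; left; apply/eqP; field; rewrite gt_eqF.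
rewrite (le_trans step)// ler_pM2r ?invr_gt0// ler_wpM2l ?mulr_ge0//.
have h : r ^+ n.+1 <= r ^+ n by rewrite exprS ler_piMl ?exprn_ge0// ltW.
by rewrite (le_trans _ h)// lerBlDr lerDl exprn_ge0.
Qed.

Lemma cauchy_cvg_bound (u : nat -> R) (B r : R) : 0 <= r < 1 ->
  (forall n k, `|u (n + k)%N - u n| <= B * r ^+ n) -> cvgn u.
Proof.
move=> /andP[r0 r1] h; apply/cauchy_cvgP/cauchy_exP => e e0.
have B0 : 0 <= B by have := h 0%N 0%N; rewrite expr0 mulr1; exact: le_trans.
have : B * r ^+ n @[n --> \oo] --> (0 : R).
  by rewrite -[X in _ --> X](mulr0 B); apply: cvgM; [exact: cvg_cst|apply: cvg_expr; rewrite ger0_norm].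
move=> /cvgrPdist_lt/(_ e e0)[n _ Hn].
exists (u n); exists n => // m /= nm.
rewrite /ball /= distrC -(subnKC nm) (le_lt_trans (h _ _))//.
have := Hn n (leqnn n); rewrite sub0r normrN; exact/le_lt_trans/ler_norm.
Qed.

Lemma dist_lim_le (u : nat -> R) (l a T : R) (n : nat) :
  u k @[k --> \oo] --> l -> (forall k, `|u (n + k)%N - a| <= T) -> `|l - a| <= T.
Proof.
move=> ul h; have {}ul : u (k + n)%N @[k --> \oo] --> l by rewrite cvg_shiftn.
have : `|u (k + n)%N - a| @[k --> \oo] --> `|l - a|.
  by apply: cvg_norm; apply: cvgB => //; exact: cvg_cst.
move=> H; rewrite -(cvg_lim _ H)//; apply: limr_le; first by apply/cvg_ex; exists `|l - a|.
by apply: nearW => k; rewrite addnC.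
Qed.

Lemma dominated_has_sumZ F B r : 0 <= r < 1 -> geom_dominated F B r ->
  has_sumZ F (sumZ F).
Proof.
move=> r01 dF; have b n k := psum_dist n k r01 dF.
have E (n : nat) : 2 * B * r ^+ n / (1 - r) = (2 * B / (1 - r)) * r ^+ n by ring.
split; rewrite /sumZ /=; apply: (cauchy_cvg_bound r01 (B := 2 * B / (1 - r))) => n k.
- by rewrite -E; have := le_trans (normc_Re _) (b n k); rewrite ReD ReN; exact: id.
- by rewrite -E; have := le_trans (normc_Im _) (b n k); rewrite ImD ImN; exact: id.
Qed.

(** The limit is taken separately on real and imaginary parts, hence twice the constant of
    [psum_dist]. *)
Lemma sumZ_tail F B r n : 0 <= r < 1 -> geom_dominated F B r ->
  normc (sumZ F - psum F n) <= 4 * B / (1 - r) * r ^+ n.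
Proof.
move=> r01 dF; have b k := psum_dist n k r01 dF.
have [hR hI] := dominated_has_sumZ r01 dF.
rewrite (le_trans (le_normc_ReIm _))//.
have -> : 4 * B / (1 - r) * r ^+ n =
  2 * B * r ^+ n / (1 - r) + 2 * B * r ^+ n / (1 - r) by ring.
rewrite ReD ImD ReN ImN; apply: lerD.
- by apply: (dist_lim_le hR) => k; have := le_trans (normc_Re _) (b k); rewrite ReD ReN; exact: id.
- by apply: (dist_lim_le hI) => k; have := le_trans (normc_Im _) (b k); rewrite ImD ImN; exact: id.
Qed.

Lemma sumZ_scale F B r c : 0 <= r < 1 -> geom_dominated F B r ->
  sumZ (fun m => c * F m) = c * sumZ F.
Proof.
move=> r01 dF; have [hR hI] := dominated_has_sumZ r01 dF.
have E n : psum (fun m => c * F m) n = c * psum F n by rewrite /psum mulr_sumr.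
apply: has_sumZE; split.
- under eq_fun do rewrite E ReM; rewrite ReM.
  by apply: cvgB; apply: cvgM => //; exact: cvg_cst.
- under eq_fun do rewrite E ImM; rewrite ImM.
  by apply: cvgD; apply: cvgM => //; exact: cvg_cst.
Qed.

(** [sumZ] is a limit over symmetric windows, so a shift of the index is not a mere relabelling: the
    windows differ by two boundary terms, which tend to 0. *)
Lemma sumZ_shift F B r : 0 <= r < 1 -> geom_dominated F B r ->
  sumZ (fun m => F (m + 1)) = sumZ F.
Proof.
move=> r01 dF; have [hR hI] := dominated_has_sumZ r01 dF.
have /andP[r0 r1] := r01.
have B0 : 0 <= B.
  by have := dF 0; rewrite expr0 mulr1; apply: le_trans; exact: normc_ge0.
have rn0 : B * r ^+ n @[n --> \oo] --> (0 : R).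
  by rewrite -[X in _ --> X](mulr0 B); apply: cvgM; [exact: cvg_cst|apply: cvg_expr; rewrite ger0_norm].
have small (u : nat -> R) : (forall n, `|u n| <= B * r ^+ n) -> u n @[n --> \oo] --> (0 : R).
  move=> h; apply/cvgr0Pnorm_le => e e0.
  move/cvgr0Pnorm_le : rn0 => /(_ e e0); apply: filterS => n; apply: le_trans.
  by rewrite (le_trans (h n))// ler_norm.
have h1 n : normc (F (- n%:Z)) <= B * r ^+ n by have := dF (- n%:Z); rewrite abszN absz_nat.
have h2 n : normc (F n.+1%:Z) <= B * r ^+ n.
  have := dF n.+1%:Z; rewrite absz_nat => /le_trans; apply.
  by rewrite ler_wpM2l// exprS ler_piMl ?exprn_ge0// ltW.
apply: has_sumZE; split.
- rewrite (_ : (fun n => complex.Re (psum (fun m => F (m + 1)) n)) =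
    (fun n => complex.Re (psum F n) - complex.Re (F (- n%:Z)) + complex.Re (F n.+1%:Z)));
    last by apply/funext => n; rewrite psum_shift !ReD ReN.
  have := cvgD (cvgB hR (small (fun n => complex.Re (F (- n%:Z)))
      (fun n => le_trans (normc_Re _) (h1 n))))
    (small (fun n => complex.Re (F n.+1%:Z)) (fun n => le_trans (normc_Re _) (h2 n))).
  by rewrite subr0 addr0 => H; exact: H.
- rewrite (_ : (fun n => complex.Im (psum (fun m => F (m + 1)) n)) =
    (fun n => complex.Im (psum F n) - complex.Im (F (- n%:Z)) + complex.Im (F n.+1%:Z)));
    last by apply/funext => n; rewrite psum_shift !ImD ImN.
  have := cvgD (cvgB hI (small (fun n => complex.Im (F (- n%:Z)))
      (fun n => le_trans (normc_Im _) (h1 n))))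
    (small (fun n => complex.Im (F n.+1%:Z)) (fun n => le_trans (normc_Im _) (h2 n))).
  by rewrite subr0 addr0 => H; exact: H.
Qed.
End Bilateral_sums.

(** * Parseval's identity and the Gaussian integral *)

Section Parseval.
Variable R : realType.
Notation C := R[i].
Notation mu := (@lebesgue_measure R).
Import ComplexField.Normc.

Lemma continuous_sum (T : topologicalType) (I : Type) (r : seq I) (F : I -> T -> R) :
  (forall i, continuous (F i)) -> continuous (fun x => \sum_(i <- r) F i x).
Proof.
move=> cF; elim: r => [|i r IH].
  by under [X in continuous X]eq_fun do rewrite big_nil; move=> x; exact: cvg_cst.
under [X in continuous X]eq_fun do rewrite big_cons.
by move=> x; apply: cvgD; [exact: cF|exact: IH].
Qed.

Lemma Rintegral_sum (a b : R) (I : Type) (r : seq I) (F : I -> R -> R) :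
  (forall i, continuous (F i)) ->
  \int[mu]_(x in `[a, b]) (\sum_(i <- r) F i x) =
  \sum_(i <- r) \int[mu]_(x in `[a, b]) F i x.
Proof.
move=> cF; elim: r => [|i r IH].
  under eq_Rintegral do rewrite big_nil.
  by rewrite big_nil Rintegral_cst ?mul0r//; exact: measurable_itv.
under eq_Rintegral do rewrite big_cons.
rewrite big_cons RintegralD; first by rewrite IH.
- exact: measurable_itv.
- exact: continuous_integrable.
- by apply: continuous_integrable; exact: continuous_sum.
Qed.

Lemma normc_sum_sqr (I : Type) (r : seq I) (z : I -> C) :
  normc (\sum_(i <- r) z i) ^+ 2 =
  \sum_(i <- r) \sum_(k <- r) complex.Re (z i * conjc (z k)).
Proof.
rewrite normc_sqr Re_sum Im_sum !expr2 !big_distrlr /= -big_split /=.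
apply: eq_bigr => i _; rewrite -big_split /=; apply: eq_bigr => k _.
by case: (z i) (z k) => a b [c d] /=; ring.
Qed.

Lemma Re_e2pi_continuous (c : C) (nu : R) : continuous (fun y : R => complex.Re (c * e2pi (nu * y))).
Proof.
under [X in continuous X]eq_fun do rewrite ReM /=.
move=> y; apply: cvgB; apply: cvgM; try exact: cvg_cst.
- apply: (cvg_comp (fun y => 2 * pi * (nu * y)) cos); last exact: continuous_cos.
  by apply: cvgM; [exact: cvg_cst|apply: cvgM; [exact: cvg_cst|exact: cvg_id]].
- apply: (cvg_comp (fun y => 2 * pi * (nu * y)) sin); last exact: continuous_sin.
  by apply: cvgM; [exact: cvg_cst|apply: cvgM; [exact: cvg_cst|exact: cvg_id]].
Qed.

(* A translation by half a period changes the sign of the integrand. *)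
Lemma integral_e2pi (c : C) (n : int) : n != 0 ->
  \int[mu]_(y in `[0, 1]) complex.Re (c * e2pi (n%:~R * y)) = 0.
Proof.
move=> n0; have nR : (n%:~R : R) != 0 by rewrite intr_eq0.
have ch : continuous (fun y : R => complex.Re (c * e2pi (n%:~R * y))).
  exact: Re_e2pi_continuous.
have := @Rintegral_periodic R _ ((2 * n%:~R)^-1) ch.
have -> : (fun x => complex.Re (c * e2pi (n%:~R * (x + (2 * n%:~R)^-1)))) =
          (fun x => -1 * complex.Re (c * e2pi (n%:~R * x))).
  apply/funext => x; rewrite mulrDr.
  have -> : n%:~R * (2 * n%:~R)^-1 = 1 / 2 :> R by field.
  by rewrite e2piD e2pi_half mulrN1 mulrN ReN mulN1r.
rewrite RintegralZl; [|exact: measurable_itv|exact: continuous_integrable].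
move=> /(_ _)/eqP; rewrite mulN1r -subr_eq0 -opprD oppr_eq0 -mulr2n mulrn_eq0 /=.
move=> H; apply/eqP; apply: H => x.
by rewrite mulrDr mulr1 e2piD e2pi_int mulr1.
Qed.

(** Only differences of frequencies occur in the squared modulus, so the frequencies themselves need
    not be integers. In the application they are half-integers when N is odd. *)
Lemma parseval (J : finType) (a : J -> R -> C) (nu : J -> R) :
  (forall i, continuous (fun x => complex.Re (a i x))) ->
  (forall i, continuous (fun x => complex.Im (a i x))) ->
  (forall i k, i != k -> exists2 n : int, n != 0 & nu i - nu k = n%:~R) ->
  liouville_measure (fun y => normc (\sum_i a i y.1 * e2pi (nu i * y.2)) ^+ 2) =
  \sum_i \int[mu]_(x in `[0, 1]) (normc (a i x) ^+ 2).
Proof.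
move=> cRe cIm dnu.
have c1 : continuous (fun x : R * R => x.1) by move=> x; exact: cvg_fst.
have c2 : continuous (fun x : R * R => x.2) by move=> x; exact: cvg_snd.
have ca (h : R -> R) (u : R * R -> R) : continuous h -> continuous u ->
    continuous (fun x => h (u x)).
  by move=> ch cu x; apply: (cvg_comp u h); [exact: cu|exact: ch].
have ccos i : continuous (fun x : R * R => cos (2 * pi * (nu i * x.2))).
  apply: (ca cos (fun x => 2 * pi * (nu i * x.2))); first exact: continuous_cos.
  by move=> x; apply: cvgM; [exact: cvg_cst|apply: cvgM; [exact: cvg_cst|exact: c2]].
have csin i : continuous (fun x : R * R => sin (2 * pi * (nu i * x.2))).
  apply: (ca sin (fun x => 2 * pi * (nu i * x.2))); first exact: continuous_sin.
  by move=> x; apply: cvgM; [exact: cvg_cst|apply: cvgM; [exact: cvg_cst|exact: c2]].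
have cRe' i : continuous (fun x : R * R => complex.Re (a i x.1)) by exact: (ca _ _ (cRe i) c1).
have cIm' i : continuous (fun x : R * R => complex.Im (a i x.1)) by exact: (ca _ _ (cIm i) c1).
have cReF i : continuous (fun y : R * R => complex.Re (a i y.1 * e2pi (nu i * y.2))).
  under [X in continuous X]eq_fun do rewrite ReM /=.
  by move=> x; apply: cvgB; apply: cvgM; [exact: cRe'|exact: ccos|exact: cIm'|exact: csin].
have cImF i : continuous (fun y : R * R => complex.Im (a i y.1 * e2pi (nu i * y.2))).
  under [X in continuous X]eq_fun do rewrite ImM /=.
  by move=> x; apply: cvgD; apply: cvgM; [exact: cRe'|exact: csin|exact: cIm'|exact: ccos].
rewrite liouville_iterl; last first.
  under [X in continuous X]eq_fun do rewrite normc_sqr Re_sum Im_sum !expr2.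
  by move=> x; apply: cvgD; apply: cvgM; apply: continuous_sum.
rewrite -Rintegral_sum; last first.
  move=> i; under [X in continuous X]eq_fun do rewrite normc_sqr !expr2.
  by move=> x; apply: cvgD; apply: cvgM; [exact: cRe|exact: cRe|exact: cIm|exact: cIm].
apply: eq_Rintegral => x _ /=.
under eq_Rintegral do rewrite normc_sum_sqr.
have E i k y : complex.Re (a i x * e2pi (nu i * y) * conjc (a k x * e2pi (nu k * y))) =
   complex.Re (a i x * conjc (a k x) * e2pi ((nu i - nu k) * y)).
  have cj : conjc (e2pi (nu k * y)) = e2pi (- nu k * y) :> C.
    by rewrite /e2pi mulNr mulrN cosN sinN.
  have cm (z w : C) : conjc (z * w) = conjc z * conjc w by exact: rmorphM.
  by rewrite cm cj mulrACA -e2piD mulrBl mulNr.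
under eq_Rintegral => y _.
  under eq_bigr => i _ do under eq_bigr => k _ do rewrite E.
  over.
rewrite Rintegral_sum; last by move=> i; apply: continuous_sum => k; exact: Re_e2pi_continuous.
apply: eq_bigr => i _; rewrite Rintegral_sum; last by move=> k; exact: Re_e2pi_continuous.
rewrite (bigD1 i) //= big1 ?addr0; last first.
  move=> k ki; rewrite eq_sym in ki; have [n n0 ->] := dnu _ _ ki.
  exact: integral_e2pi.
under eq_Rintegral do rewrite subrr mul0r e2pi0 mulr1.
rewrite Rintegral_cst; last exact: measurable_itv.
have -> : fine (mu `[0, 1]) = 1.
  by rewrite lebesgue_measure_itv /= lte_fin ltr01 oppr0 addr0.
by rewrite mulr1 normc_sqr; case: (a i x) => u v /=; ring.
Qed.

(** The windows are the unions of the unit intervals [0, 1] - q - m for |m| <= n. The integrand is a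
    multiple of the normal density of variance 1/(2c), whose total probability 1 is approached along
    these increasing windows. *)
Lemma gaussian_unfold (c q : R) : 0 < c ->
  \int[mu]_(x in `[- n%:R - q, n%:R + 1 - q]) expR (- c * x ^+ 2) @[n --> \oo] -->
  Num.sqrt (pi / c).
Proof.
move=> c0; pose s : R := Num.sqrt (2 * c)^-1.
have s0 : 0 < s by rewrite sqrtr_gt0 invr_gt0 mulr_gt0.
have s2 : s ^+ 2 = (2 * c)^-1 by rewrite sqr_sqrtr// invr_ge0 mulr_ge0// ltW.
have pk : normal_peak s = (Num.sqrt (pi / c))^-1.
  by rewrite /normal_peak s2; congr (Num.sqrt _)^-1; rewrite -mulr_natr; field; rewrite gt_eqF.
have pc0 : 0 < Num.sqrt (pi / c) by rewrite sqrtr_gt0 divr_gt0// pi_gt0.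
have pdfE x : normal_pdf 0 s x = (Num.sqrt (pi / c))^-1 * expR (- c * x ^+ 2).
  rewrite normal_pdfE ?gt_eqF//= pk /normal_fun subr0 s2; congr (_ * expR _).
  by rewrite -[in LHS]mulr_natr; field; rewrite gt_eqF.
pose F n : set R := [set` `[- n%:R - q, n%:R + 1 - q]].
have cg : continuous (fun x : R => expR (- c * x ^+ 2)).
  move=> x; apply: (cvg_comp (fun x => - c * x ^+ 2) expR); last exact: continuous_expR.
  by apply: cvgM; [exact: cvg_cst|exact: exprn_continuous].
have H : normal_prob 0 s (F n) @[n --> \oo] --> (1 : \bar R)%E.
  have -> : (1 : \bar R)%E = normal_prob 0 s (\bigcup_n F n).
    rewrite (_ : \bigcup_n F n = setT) ?probability_setT//.
    apply/seteqP; split => // x _; exists (Num.truncn (`|x| + `|q|)).+1 => //.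
    rewrite /F /= in_itv /=.
    have h := truncnS_gt (`|x| + `|q|); have := ler_norm x; have := ler_norm q.
    have := ler_norm (- x); have := ler_norm (- q); rewrite !normrN.
    by move=> h1 h2 h3 h4; apply/andP; split; lra.
  apply: nondecreasing_cvg_mu.
  - by move=> n; exact: measurable_itv.
  - by apply: bigcup_measurable => n _; exact: measurable_itv.
  - move=> n m nm; apply/subsetPset => x; rewrite /F /= !in_itv /= => /andP[h1 h2].
    have : (n%:R : R) <= m%:R by rewrite ler_nat.
    by move=> h; apply/andP; split; lra.
have E n : \int[mu]_(x in F n) expR (- c * x ^+ 2) =
    Num.sqrt (pi / c) * fine (normal_prob 0 s (F n)).
  rewrite /normal_prob -[fine _]/(\int[mu]_(x in F n) normal_pdf 0 s x).
  under [in RHS]eq_Rintegral do rewrite pdfE.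
  rewrite RintegralZl; [|exact: measurable_itv|exact: continuous_integrable].
  by rewrite mulrA divff ?mul1r// gt_eqF.
under eq_fun do rewrite E.
have H1 : fine (normal_prob 0 s (F n)) @[n --> \oo] --> (1 : R) by exact: fine_cvg H.
have := cvgM (cvg_cst (Num.sqrt (pi / c))) H1.
by rewrite mulr1; apply.
Qed.
End Parseval.

Section Complex_continuity.
Variable R : realType.
Notation C := R[i].
Import ComplexField.Normc.

Definition ccontinuous (T : topologicalType) (F : T -> C) :=
  continuous (fun x => complex.Re (F x)) /\ continuous (fun x => complex.Im (F x)).

Lemma ccontinuousM (T : topologicalType) (F G : T -> C) :
  ccontinuous F -> ccontinuous G -> ccontinuous (fun x => F x * G x).
Proof.
move=> [F1 F2] [G1 G2]; split.
- under [X in continuous X]eq_fun do rewrite ReM.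
  by move=> x; apply: cvgB; apply: cvgM; [exact: F1|exact: G1|exact: F2|exact: G2].
- under [X in continuous X]eq_fun do rewrite ImM.
  by move=> x; apply: cvgD; apply: cvgM; [exact: F1|exact: G2|exact: F2|exact: G1].
Qed.

Lemma ccontinuous_cst (T : topologicalType) (z : C) : ccontinuous (fun _ : T => z).
Proof. by split => x; exact: cvg_cst. Qed.

Lemma ccontinuous_sum (T : topologicalType) (I : Type) (r : seq I) (F : I -> T -> C) :
  (forall i, ccontinuous (F i)) -> ccontinuous (fun x => \sum_(i <- r) F i x).
Proof.
move=> cF; split.
- under [X in continuous X]eq_fun do rewrite Re_sum.
  by apply: continuous_sum => i; have [] := cF i.
- under [X in continuous X]eq_fun do rewrite Im_sum.
  by apply: continuous_sum => i; have [] := cF i.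
Qed.

Lemma ccontinuous_real (T : topologicalType) (u : T -> R) :
  continuous u -> ccontinuous (fun x => (u x)%:C).
Proof. by move=> cu; split => // x; exact: cvg_cst. Qed.

Lemma ccontinuous_cexp (T : topologicalType) (F : T -> C) :
  ccontinuous F -> ccontinuous (fun x => cexp (F x)).
Proof.
move=> [F1 F2]; split => x /=; apply: cvgM.
- by apply: (cvg_comp (fun x => complex.Re (F x)) expR); [exact: F1|exact: continuous_expR].
- by apply: (cvg_comp (fun x => complex.Im (F x)) cos); [exact: F2|exact: continuous_cos].
- by apply: (cvg_comp (fun x => complex.Re (F x)) expR); [exact: F1|exact: continuous_expR].
- by apply: (cvg_comp (fun x => complex.Im (F x)) sin); [exact: F2|exact: continuous_sin].
Qed.

Lemma ccontinuous_e2pi (T : topologicalType) (u : T -> R) :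
  continuous u -> ccontinuous (fun x => e2pi (u x)).
Proof.
move=> cu; have c2 : continuous (fun x => 2 * pi * u x).
  by move=> x; apply: cvgM; [exact: cvg_cst|exact: cu].
split => x /=.
- by apply: (cvg_comp (fun x => 2 * pi * u x) cos); [exact: c2|exact: continuous_cos].
- by apply: (cvg_comp (fun x => 2 * pi * u x) sin); [exact: c2|exact: continuous_sin].
Qed.

Lemma ccontinuous_normc_sqr (T : topologicalType) (F : T -> C) :
  ccontinuous F -> continuous (fun x => normc (F x) ^+ 2).
Proof.
move=> [F1 F2]; under [X in continuous X]eq_fun do rewrite normc_sqr !expr2.
by move=> x; apply: cvgD; apply: cvgM; [exact: F1|exact: F1|exact: F2|exact: F2].
Qed.

(** Only the first coordinate of y is restricted: the second enters a theta term through a factor of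
    modulus 1 and does not affect the tails. *)
Lemma locally_uniform_ccontinuous (F : R * R -> C) (Fn : nat -> R * R -> C) :
  (forall n, ccontinuous (Fn n)) ->
  (forall (x : R * R) e, 0 < e -> exists n, forall y : R * R, `|y.1 - x.1| < 1 ->
     normc (F y - Fn n y) < e) ->
  ccontinuous F.
Proof.
move=> cFn H.
have aux (p : C -> R) : (forall z w, p (z - w) = p z - p w) ->
    (forall z, `|p z| <= normc z) -> (forall n, continuous (fun x => p (Fn n x))) ->
    continuous (fun x => p (F x)).
  move=> pB pn cp; apply/continuous2P => x e e0.
  have [n Hn] := H x _ (divr_gt0 e0 (ltr0Sn R 2)).
  have [d d0 Hd] := (continuous2P _).1 (cp n) x _ (divr_gt0 e0 (ltr0Sn R 2)).
  exists (Num.min d 1); first by rewrite lt_min d0 ltr01.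
  move=> y; rewrite !lt_min => /andP[y1 y2] /andP[y3 _].
  have h1 := le_lt_trans (pn _) (Hn y y2).
  have h2 : `|p (F x - Fn n x)| < e / 3.
    by apply: le_lt_trans (pn _) (Hn x _); rewrite subrr normr0.
  have h3 := Hd y y1 y3.
  have -> : p (F y) - p (F x) = p (F y - Fn n y) + (p (Fn n y) - p (Fn n x))
     - p (F x - Fn n x) by rewrite !pB; ring.
  rewrite (le_lt_trans (ler_normB _ _))// (le_lt_trans (lerD (ler_normD _ _) (lexx _)))//.
  lra.
split; apply: aux.
- by move=> z w; rewrite ReD ReN.
- exact: normc_Re.
- by move=> n; have [] := cFn n.
- by move=> z w; rewrite ImD ImN.
- exact: normc_Im.
- by move=> n; have [] := cFn n.
Qed.
End Complex_continuity.

(** * Theta functions: convergence, quasi-periodicity, continuity *)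

Section Theta.
Variables (R : realType) (N : nat) (t : R[i]).
Notation C := R[i].
Notation mu := (@lebesgue_measure R).
Import ComplexField.Normc.
Hypotheses (N0 : (0 < N)%N) (t0 : 0 < complex.Re t).

Definition gauss_term (q : R) (x : R) (m : int) : C :=
  (-1) ^ m * cexp (- (pi * N%:R)%:C * t * ((x - q - m%:~R) ^+ 2)%:C).

Definition theta_term (q : R) (y : R * R) (m : int) : C :=
  gauss_term q y.1 m * e2pi (- (N%:R * (q + m%:~R)) * y.2).

Definition theta (q : R) (y : R * R) : C := sumZ (theta_term q y).

Let al : R := pi * N%:R * complex.Re t.

Let al0 : 0 < al.
Proof. by rewrite !mulr_gt0 ?pi_gt0 ?ltr0n. Qed.

Let r : R := expR (- (al / 2)).

Let r01 : 0 <= r < 1.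
Proof. by rewrite expR_ge0 /r -[ltRHS]expR0 ltr_expR oppr_lt0 divr_gt0. Qed.

Lemma normc_gauss_term q x m :
  normc (gauss_term q x m) = expR (- al * (x - q - m%:~R) ^+ 2).
Proof.
rewrite /gauss_term normcM normc_signz mul1r normc_cexp; congr expR.
by rewrite !(ReM, ImM, ReN, ImN) /= /al; ring.
Qed.

Lemma normc_theta_term q y m :
  normc (theta_term q y m) = expR (- al * (y.1 - q - m%:~R) ^+ 2).
Proof. by rewrite /theta_term normcM normc_e2pi mulr1 normc_gauss_term. Qed.

(** With s = y1 - q one has (s - m)^2 + s^2 = m^2/2 + 2 (s - m/2)^2 >= m^2/2 >= |m|/2, the last step
    because m is an integer. Hence the ratio exp(- al/2) and the factor exp(al b^2). *)
Lemma theta_dominated q y b : `|y.1 - q| <= b ->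
  geom_dominated (theta_term q y) (expR (al * b ^+ 2)) r.
Proof.
move=> yb m; rewrite normc_theta_term /r -expRM_natl -expRD ler_expR.
have b2 : (y.1 - q) ^+ 2 <= b ^+ 2.
  by rewrite -real_normK ?num_real// lerXn2r ?nnegrE// (le_trans _ yb).
have m2 : (`|m|%N%:R : R) <= (m%:~R) ^+ 2.
  rewrite -real_normK ?num_real// -intr_norm -[_%:R]/(`|m|%N%:Z%:~R) -abszE.
  by rewrite expr2 -intrM ler_int; case: `|m|%N => // k; nia.
rewrite -subr_ge0.
have -> : al * b ^+ 2 + `|m|%N%:R * - (al / 2) - - al * (y.1 - q - m%:~R) ^+ 2 =
  al * ((b ^+ 2 - (y.1 - q) ^+ 2) + ((m%:~R) ^+ 2 - `|m|%N%:R) / 2 +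
        2 * ((y.1 - q) - m%:~R / 2) ^+ 2) by field.
apply: mulr_ge0; first exact: ltW.
apply: addr_ge0; last by rewrite pmulr_rge0// sqr_ge0.
by apply: addr_ge0; [rewrite subr_ge0|rewrite divr_ge0// subr_ge0].
Qed.

Lemma theta_dominated' q y :
  geom_dominated (theta_term q y) (expR (al * `|y.1 - q| ^+ 2)) r.
Proof. exact: theta_dominated. Qed.

(** The translation is absorbed by m -> m + 1. The resulting factor does not involve q, so it is
    common to all terms of a linear combination. *)
Lemma theta_shift_fst q y : theta q (y + (1, 0)) = - e2pi (- N%:R * y.2) * theta q y.
Proof.
rewrite /theta -(sumZ_shift r01 (theta_dominated' q (y + (1, 0)))).
rewrite -(sumZ_scale _ r01 (theta_dominated' q y)); congr sumZ; apply/funext => m.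
rewrite /theta_term /gauss_term /= exprzDr ?unitrN1// expr1z mulrN1 addr0.
have -> : y.1 + 1 - q - (m + 1)%:~R = y.1 - q - m%:~R by rewrite intrD; ring.
have -> : - (N%:R * (q + (m + 1)%:~R)) * y.2 =
  - N%:R * y.2 + - (N%:R * (q + m%:~R)) * y.2 by rewrite intrD; ring.
by rewrite e2piD; ring.
Qed.

(** The frequency is N (q + m) = N/2 - l + N m, and both l s and m N s are integers, so only the
    phase of N s/2 survives, the same for every such l. The case s = 1 gives periodicity and s = 1/g
    the additional invariance. *)
Lemma theta_shift_snd (l : nat) (s : R) (n1 n2 : int) y :
  N%:R * s = n1%:~R -> l%:R * s = n2%:~R ->
  theta (1 / 2 - l%:R / N%:R) (y + (0, s)) =
  e2pi (- (N%:R * s / 2)) * theta (1 / 2 - l%:R / N%:R) y.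
Proof.
move=> e1 e2; have NR : (N%:R : R) != 0 by rewrite pnatr_eq0 -lt0n.
rewrite /theta -(sumZ_scale _ r01 (theta_dominated' _ y)); congr sumZ; apply/funext => m.
rewrite /theta_term /= addr0 mulrCA; congr (_ * _).
have -> : - (N%:R * (1 / 2 - l%:R / N%:R + m%:~R)) * (y.2 + s) =
  - (N%:R * s / 2) + - (N%:R * (1 / 2 - l%:R / N%:R + m%:~R)) * y.2 +
  (l%:R * s - m%:~R * (N%:R * s)) by field.
by rewrite 2!e2piD e1 e2 -intrM -intrB e2pi_int mulr1.
Qed.

Lemma gauss_term_ccontinuous (T : topologicalType) (u : T -> R) q m : continuous u ->
  ccontinuous (fun x => gauss_term q (u x) m).
Proof.
move=> cu; apply: ccontinuousM; first exact: ccontinuous_cst.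
apply: ccontinuous_cexp; apply: ccontinuousM; first exact: ccontinuous_cst.
have c1 : continuous (fun x => u x - q - m%:~R).
  by move=> x; apply: cvgB; [apply: cvgB; [exact: cu|exact: cvg_cst]|exact: cvg_cst].
apply: ccontinuous_real; under [X in continuous X]eq_fun do rewrite expr2.
by move=> x; apply: cvgM; exact: c1.
Qed.

Lemma theta_term_ccontinuous q m : ccontinuous (fun y => theta_term q y m).
Proof.
apply: ccontinuousM.
  by apply: gauss_term_ccontinuous => x; exact: cvg_fst.
by apply: ccontinuous_e2pi => x; apply: cvgM; [exact: cvg_cst|exact: cvg_snd].
Qed.

Lemma theta_ccontinuous q : ccontinuous (theta q).
Proof.
apply: (@locally_uniform_ccontinuous _ _ (fun n y => psum (theta_term q y) n)).
  by move=> n; apply: ccontinuous_sum => k; exact: theta_term_ccontinuous.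
move=> x e e0; pose b := `|x.1 - q| + 1.
pose K := 4 * expR (al * b ^+ 2) / (1 - r).
have /andP[r0 r1] := r01.
have : K * r ^+ n @[n --> \oo] --> (0 : R).
  have := cvgM (cvg_cst K) (cvg_expr (z := r) _); rewrite mulr0; apply.
  by rewrite ger0_norm.
move=> /cvgr0Pnorm_lt/(_ e e0)[n _ Hn]; exists n => y y1.
have yb : `|y.1 - q| <= b.
  have -> : y.1 - q = (x.1 - q) + (y.1 - x.1) by ring.
  by rewrite (le_trans (ler_normD _ _))// lerD2l ltW.
rewrite (le_lt_trans (sumZ_tail n r01 (theta_dominated yb)))//.
exact: le_lt_trans (ler_norm _) (Hn n (leqnn n)).
Qed.
End Theta.

Lemma cvg_sumr (R : realType) (I : Type) (s : seq I) (u : I -> nat -> R) (v : I -> R) :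
  (forall i, u i n @[n --> \oo] --> v i) ->
  \sum_(i <- s) u i n @[n --> \oo] --> \sum_(i <- s) v i.
Proof.
move=> uv; elim: s => [|i s IH].
  by under eq_fun do rewrite big_nil; rewrite big_nil; exact: cvg_cst.
by under eq_fun do rewrite big_cons; rewrite big_cons; apply: cvgD.
Qed.

(** * Modulus and mass of a combination of theta functions *)

Section Theta_combination.
Variables (R : realType) (N : nat) (t : R[i]) (p : nat).
Notation C := R[i].
Notation mu := (@lebesgue_measure R).
Import ComplexField.Normc.
Hypotheses (N0 : (0 < N)%N) (t0 : 0 < complex.Re t).
Variables (c : 'I_p -> C) (l : 'I_p -> nat).
Hypotheses (lN : forall s, (l s < N)%N) (l_inj : injective l).

Let q (s : 'I_p) : R := 1 / 2 - (l s)%:R / N%:R.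

Definition theta_comb (y : R * R) : C :=
  \sum_(s < p) c s * theta N t (1 / 2 - (l s)%:R / N%:R) y.

Let al : R := pi * N%:R * complex.Re t.

Let al0 : 0 < al.
Proof. by rewrite !mulr_gt0 ?pi_gt0 ?ltr0n. Qed.

Let r : R := expR (- (al / 2)).

Let r01 : 0 <= r < 1.
Proof. by rewrite expR_ge0 /r -[ltRHS]expR0 ltr_expR oppr_lt0 divr_gt0. Qed.

Lemma theta_comb_ccontinuous : ccontinuous theta_comb.
Proof.
apply: ccontinuous_sum => s; apply: ccontinuousM; first exact: ccontinuous_cst.
exact: theta_ccontinuous.
Qed.

Lemma normc_theta_comb_shift_fst y : normc (theta_comb (y + (1, 0))) = normc (theta_comb y).
Proof.
have -> : theta_comb (y + (1, 0)) = - e2pi (- N%:R * y.2) * theta_comb y.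
  rewrite /theta_comb mulr_sumr; apply: eq_bigr => s _.
  by rewrite theta_shift_fst// mulrCA.
by rewrite normcM normcN normc_e2pi mul1r.
Qed.

Lemma normc_theta_comb_shift_snd y (w : R) (n1 : int) :
  N%:R * w = n1%:~R -> (forall s, exists n2 : int, (l s)%:R * w = n2%:~R) ->
  normc (theta_comb (y + (0, w))) = normc (theta_comb y).
Proof.
move=> e1 e2.
have -> : theta_comb (y + (0, w)) = e2pi (- (N%:R * w / 2)) * theta_comb y.
  rewrite /theta_comb mulr_sumr; apply: eq_bigr => s _; have [n2 e] := e2 s.
  by rewrite (theta_shift_snd N0 t0 _ e1 e) mulrCA.
by rewrite normcM normc_e2pi mul1r.
Qed.

Let Phin (M : nat) (y : R * R) : C :=
  \sum_(s < p) c s * psum (theta_term N t (q s) y) M.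

(** On the unit square |y1 - q| <= 2, because q lies between -1/2 and 1/2. *)
Let B := expR (al * 2 ^+ 2).

Let sq_dominated s y : unit_square y -> geom_dominated (theta_term N t (q s) y) B r.
Proof.
case: y => y1 y2 [/=]; rewrite !in_itv /= => /andP[h1 h2] _.
apply: theta_dominated => //=; rewrite /q.
have NR : (0 : R) < N%:R by rewrite ltr0n.
have h3 : (l s)%:R / N%:R < 1 :> R by rewrite ltr_pdivrMr// mul1r ltr_nat.
have h4 : 0 <= (l s)%:R / N%:R :> R by rewrite divr_ge0.
by apply/ler_normlP; split; lra.
Qed.

Let Phin_dist M y : unit_square y ->
  normc (theta_comb y - Phin M y) <= (\sum_s normc (c s)) * (4 * B / (1 - r)) * r ^+ M.
Proof.
move=> sy; rewrite /theta_comb /Phin -sumrB (le_trans (normc_sum _ _))//.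
rewrite -mulrA mulr_suml ler_sum// => s _; rewrite -mulrBr normcM ler_wpM2l ?normc_ge0//.
exact: (sumZ_tail M r01 (sq_dominated s sy)).
Qed.

Let Phin_bound M y : unit_square y ->
  normc (Phin M y) <= (\sum_s normc (c s)) * (B + 2 * B / (1 - r)).
Proof.
move=> sy; rewrite /Phin (le_trans (normc_sum _ _))//.
rewrite mulr_suml ler_sum// => s _; rewrite normcM ler_wpM2l ?normc_ge0//.
have dF := sq_dominated s sy.
have -> : psum (theta_term N t (q s) y) M = psum (theta_term N t (q s) y) 0 +
  (psum (theta_term N t (q s) y) (0 + M) - psum (theta_term N t (q s) y) 0).
  by rewrite add0n addrC subrK.
rewrite (le_trans (le_normcD _ _))// lerD//.
  by rewrite /psum big_ord_recl big_ord0 addr0 (le_trans (dF _))// mulr1.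
by rewrite (le_trans (psum_dist 0 M r01 dF))// expr0 mulr1.
Qed.

(** Parseval over the pairs (s, m). Two frequencies differ by l s - l s' + N (k' - k); if this
    vanishes, the indices agree modulo N, hence are equal since both are below N, and then k = k'.
    Squaring the modulus doubles the exponent [al]. *)
Let Phin_integral M : liouville_measure (fun y => normc (Phin M y) ^+ 2) =
  \sum_(s < p) normc (c s) ^+ 2 *
    \int[mu]_(x in `[- M%:R - q s, M%:R + 1 - q s]) expR (- (2 * al) * x ^+ 2).
Proof.
pose J := ('I_p * 'I_(M.*2.+1))%type.
pose m (i : J) : int := i.2%:Z - M%:Z.
pose a (i : J) (x : R) : C := c i.1 * gauss_term N t (q i.1) x (m i).
pose nu (i : J) : R := - (N%:R * (q i.1 + (m i)%:~R)).
have PhinE y : Phin M y = \sum_i a i y.1 * e2pi (nu i * y.2).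
  rewrite /Phin; under eq_bigr do rewrite /psum mulr_sumr.
  by rewrite pair_big; apply: eq_bigr => -[s k] _; rewrite /a /nu /theta_term mulrA.
under [X in liouville_measure X]eq_fun do rewrite PhinE.
have ca i : ccontinuous (a i).
  apply: ccontinuousM; first exact: ccontinuous_cst.
  by apply: gauss_term_ccontinuous => x; exact: cvg_id.
rewrite parseval; [|by move=> i; have [] := ca i|by move=> i; have [] := ca i|]; last first.
  have NR : (N%:R : R) != 0 by rewrite pnatr_eq0 -lt0n.
  move=> [s k] [s' k'] sk.
  exists ((l s)%:Z - (l s')%:Z + N%:Z * (k'%:Z - k%:Z)).
    apply: contra sk => /eqP E.
    have ll : l s = l s'.
      have : ((l s)%:Z == (l s')%:Z %[mod N%:Z])%Z.
        rewrite eqz_mod_dvd; apply/dvdzP; exists (k%:Z - k'%:Z).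
        by apply/eqP; rewrite -subr_eq0 -[X in _ == X]E; apply/eqP; ring.
      by rewrite !modz_nat !modn_small// => /eqP[].
    rewrite xpair_eqE (l_inj ll) eqxx /=; apply/eqP/val_inj => /=.
    move: E; rewrite ll subrr add0r => /eqP; rewrite mulf_eq0 eqz_nat -[N == 0%N]negbK -lt0n N0 /=.
    by rewrite subr_eq0 eqz_nat => /eqP.
  rewrite /nu /m /q /= !(intrD, intrB, intrM) /=.
  by rewrite -!pmulrn; field.
have ce : continuous (fun x : R => expR (- (2 * al) * x ^+ 2)).
  move=> x; apply: (cvg_comp (fun x => - (2 * al) * x ^+ 2) expR); last exact: continuous_expR.
  by apply: cvgM; [exact: cvg_cst|exact: exprn_continuous].
(* Unfolding: the translates of [0, 1] belonging to the successive m are adjacent and add up to one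
   long interval. *)
have cat (z : R) (n : nat) :
    \sum_(k < n) \int[mu]_(x in `[z - k%:R, z - k%:R + 1]) expR (- (2 * al) * x ^+ 2) =
    \int[mu]_(x in `[z + 1 - n%:R, z + 1]) expR (- (2 * al) * x ^+ 2).
  elim: n => [|n IH].
    by rewrite big_ord0 subr0 set_itv1 Rintegral_set1.
  rewrite big_ord_recr IH /= addrC -[z - n%:R + 1]addrAC.
  rewrite -(@Rintegral_itv_cat _ _ (z - n%:R) (z + 1 - n%:R))//; [|lra|].
    by have -> : z + 1 - n.+1%:R = z - n%:R by rewrite -natr1; ring.
  by rewrite gerBl.
rewrite -(pair_big xpredT xpredT (fun s k => \int[mu]_(x in `[0, 1]) (normc (a (s, k) x) ^+ 2))) /=.
apply: eq_bigr => s _.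
have -> : - M%:R - q s = (M%:R - q s) + 1 - (M.*2.+1)%:R.
  by rewrite -natr1 -muln2 natrM; ring.
have -> : M%:R + 1 - q s = (M%:R - q s) + 1 by ring.
rewrite -cat mulr_sumr; apply: eq_bigr => k _.
rewrite -RintegralZl; [|exact: measurable_itv|exact: continuous_integrable].
have ch : continuous (fun x : R => normc (c s) ^+ 2 * expR (- (2 * al) * x ^+ 2)).
  by move=> x; apply: cvgM; [exact: cvg_cst|exact: ce].
have := @Rintegral_shift _ _ (- q s - (k%:R - M%:R)) 0 1 ch ler01.
rewrite add0r.
have -> : M%:R - q s - k%:R = - q s - (k%:R - M%:R) by ring.
have -> : - q s - (k%:R - M%:R) + 1 = 1 + (- q s - (k%:R - M%:R)) by ring.
move=> <-; apply: eq_Rintegral => x _.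
rewrite /a normcM normc_gauss_term exprMn; congr (_ * _).
rewrite -expRM_natl; congr expR; rewrite /m intrB /al /=.
ring.
Qed.

(** The truncated masses have two limits, the Gaussian integrals by unfolding and the full mass by
    uniform convergence on the unit square; uniqueness of limits identifies them. *)
Lemma theta_comb_mass :
  liouville_measure (fun y => normc (theta_comb y) ^+ 2) =
  (\sum_(s < p) normc (c s) ^+ 2) * Num.sqrt (pi / (2 * al)).
Proof.
pose I M := liouville_measure (fun y => normc (Phin M y) ^+ 2).
have c1 : continuous (fun y => normc (theta_comb y) ^+ 2).
  exact/ccontinuous_normc_sqr/theta_comb_ccontinuous.
have cn M : continuous (fun y => normc (Phin M y) ^+ 2).
  apply: ccontinuous_normc_sqr; apply: ccontinuous_sum => s.
  apply: ccontinuousM; first exact: ccontinuous_cst.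
  by apply: ccontinuous_sum => k; exact: theta_term_ccontinuous.
have lim1 : I M @[M --> \oo] --> (\sum_(s < p) normc (c s) ^+ 2) * Num.sqrt (pi / (2 * al)).
  rewrite /I; under eq_fun do rewrite Phin_integral.
  rewrite mulr_suml; apply: cvg_sumr => s; apply: cvgM; first exact: cvg_cst.
  by apply: gaussian_unfold; rewrite mulr_gt0.
have lim2 : I M @[M --> \oo] --> liouville_measure (fun y => normc (theta_comb y) ^+ 2).
  have /andP[r0 r1] := r01.
  pose Sc := \sum_s normc (c s).
  have Sc0 : 0 <= Sc by apply: sumr_ge0 => s _; exact: normc_ge0.
  have B0 : 0 < B by exact: expR_gt0.
  have q0 : 0 < 1 - r by rewrite subr_gt0.
  pose K1 := Sc * (4 * B / (1 - r)); pose K2 := Sc * (B + 2 * B / (1 - r)).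
  have K10 : 0 <= K1 by rewrite mulr_ge0// divr_ge0 ?(ltW q0)// mulr_ge0// ltW.
  have K20 : 0 <= K2 by rewrite mulr_ge0// addr_ge0 ?(ltW B0)// divr_ge0 ?(ltW q0)// mulr_ge0// ltW.
  (* From |A^2 - B^2| = |A - B| (A + B): the first factor is at most K1 r^M, and B <= K2 with A <=
     K2 + K1. *)
  pose K := K1 * (2 * K2 + K1).
  have diff M y : unit_square y ->
     `|normc (theta_comb y) ^+ 2 - normc (Phin M y) ^+ 2| <= K * r ^+ M.
    move=> sy; have h1 := Phin_dist M sy; have h2 := Phin_bound M sy.
    rewrite -/Sc -/K1 in h1; rewrite -/Sc -/K2 in h2.
    have rM : r ^+ M <= 1 by rewrite exprn_ile1// ltW.
    have h3 : `|normc (theta_comb y) - normc (Phin M y)| <= K1 * r ^+ M.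
      rewrite (le_trans _ h1)// ler_norml; apply/andP; split.
        rewrite lerNl opprB lerBlDr.
        have -> : Phin M y = - (theta_comb y - Phin M y) + theta_comb y.
          by rewrite opprB subrK.
        by rewrite (le_trans (le_normcD _ _))// normcN opprB subrK.
      rewrite lerBlDr -{1}[theta_comb y](subrK (Phin M y)).
      exact: le_normcD.
    rewrite subr_sqr normrM /K mulrAC ler_pM//.
    rewrite [leLHS]ger0_norm ?addr_ge0 ?normc_ge0//.
    have h4 : normc (theta_comb y) - normc (Phin M y) <= K1.
      rewrite (le_trans (ler_norm _))// (le_trans h3)// ler_piMr//.
    lra.
  apply/cvgrPdist_le => e e0.
  have : K * r ^+ n @[n --> \oo] --> (0 : R).
    have := cvgM (cvg_cst K) (cvg_expr (z := r) _); rewrite mulr0; apply.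
    by rewrite ger0_norm.
  move/cvgr0Pnorm_le/(_ e e0); apply: filterS => M hM.
  have {}hM : K * r ^+ M <= e by rewrite (le_trans (ler_norm _)).
  rewrite /I ler_distl; apply/andP; split.
    rewrite lerBlDr -[X in _ <= _ + X](liouville_cst e) -liouvilleD//; last by move=> x; exact: cvg_cst.
    apply: le_liouville => //.
      by move=> x; apply: cvgD; [exact: c1|exact: cvg_cst].
    move=> y sy; have := diff M y sy; rewrite ler_distl => /andP[h h']; lra.
  rewrite -[X in _ <= _ + X](liouville_cst e) -liouvilleD//; last by move=> x; exact: cvg_cst.
  apply: le_liouville => //.
    by move=> x; apply: cvgD; [exact: cn|exact: cvg_cst].
  move=> y sy; have := diff M y sy; rewrite ler_distl => /andP[h h']; lra.
rewrite -(cvg_lim _ lim1)// -(cvg_lim _ lim2)//.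
Qed.
End Theta_combination.

(** * Husimi densities of crystal states *)

Section Kernel.
Variables (R : realType) (j : 'M[R]_2 -> R[i]).
Notation C := R[i].
Import ComplexField.Normc.
Hypothesis hj : root_choice j.

(* The complex width (a - ic) / (d + ib) of the Gaussian in the kernel of U_S. *)
Definition width (S : 'M[R]_2) : C :=
  ((S 1 1 ^+ 2 + S 0 1 ^+ 2)^-1) -i*
  ((S 0 0 * S 0 1 + S 1 0 * S 1 1) / (S 1 1 ^+ 2 + S 0 1 ^+ 2)).

Definition lin_map (S : 'M[R]_2) (y : R * R) : R * R :=
  (S 0 0 * y.1 + S 0 1 * y.2, S 1 0 * y.1 + S 1 1 * y.2).

Definition kernel_cst (N : nat) (S : 'M[R]_2) : C :=
  (((pi * hbar R N) `^ (1 / 4))^-1)%:C * (j S)^-1.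

Lemma det2 (K : comNzRingType) (S : 'M[K]_2) : \det S = S 0 0 * S 1 1 - S 0 1 * S 1 0.
Proof.
rewrite (expand_det_row S ord0) !big_ord_recl big_ord0 /cofactor !det_mx11 !mxE /=.
rewrite !expr0 !expr1 !mul1r addr0 mulN1r mulrN.
by congr (_ * S _ _ - S _ _ * S _ _); apply/val_inj.
Qed.

Lemma width_den (S : 'M[R]_2) : \det S = 1 -> 0 < S 1 1 ^+ 2 + S 0 1 ^+ 2.
Proof.
rewrite det2 => det; rewrite lt_def addr_ge0 ?sqr_ge0// andbT.
apply/eqP => /eqP; rewrite paddr_eq0 ?sqr_ge0// !sqrf_eq0 => /andP[/eqP h1 /eqP h2].
by move/eqP: det; rewrite h1 h2 mulr0 mul0r subrr eq_sym oner_eq0.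
Qed.

Lemma normc_phase_pt (x : R * R) :
  normc (phase_pt x) ^+ 2 = (x.1 ^+ 2 + x.2 ^+ 2) / 2.
Proof.
rewrite normc_sqr /= sqrrN !exprMn exprVn sqr_sqrtr// -mulrDl //.
Qed.

(* With y = S^-1 x, the exponent of the kernel becomes a Gaussian in y1 - q
   times a phase which is linear in q. *)
Lemma kernel_exponent (S : 'M[R]_2) (q : R) (y : R * R) : \det S = 1 ->
  let z := phase_pt (lin_map S y) in
  - (S 1 1 -i* S 0 1) * z ^+ 2 - (S 0 0 -i* S 1 0) * (q ^+ 2)%:C
    + (2 * Num.sqrt 2 * q)%:C * z =
  (S 1 1 +i* S 0 1) * ((normc z ^+ 2) +i* (y.1 * y.2 - 2 * q * y.2)
     - width S * ((y.1 - q) ^+ 2)%:C).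
Proof.
move=> det z; have D0 := width_den det.
have sq2 : (Num.sqrt 2 : R) != 0 by rewrite gt_eqF// sqrtr_gt0.
have sq22 : (Num.sqrt 2 : R) ^+ 2 = 2 by rewrite sqr_sqrtr.
rewrite [RHS]mulrBr [X in _ = _ - X]mulrA.
have -> : (S 1 1 +i* S 0 1) * width S = S 0 0 -i* S 1 0.
  rewrite det2 in det; move: det D0; rewrite /width.
  move: (S 0 0) (S 0 1) (S 1 0) (S 1 1) => a b c d det D0.
  apply/eqP; rewrite eq_complex /=; apply/andP; split; apply/eqP;
    apply: (mulIf (lt0r_neq0 D0)).
  - transitivity (d + b * (a * b + c * d)); first by field; rewrite gt_eqF.
    by rewrite -[X in X + _ = _]mulr1 -det; ring.
  - transitivity (b - d * (a * b + c * d)); first by field; rewrite gt_eqF.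
    by rewrite -[X in X - _ = _]mulr1 -det; ring.
have -> : z ^+ 2 = (((lin_map S y).1 ^+ 2 - (lin_map S y).2 ^+ 2) / 2) -i*
   ((lin_map S y).1 * (lin_map S y).2).
  rewrite /z /phase_pt; move: (lin_map S y) (Num.sqrt 2) sq2 sq22 => [x1 x2] s s0 s2 /=.
  apply/eqP; rewrite expr2 eq_complex /=; apply/andP; split; apply/eqP.
  - by rewrite -s2; field.
  - transitivity (- (x1 * x2) * (2 / s ^+ 2)); first by field.
    by rewrite s2 divff ?mulr1.
have -> : (2 * Num.sqrt 2 * q)%:C * z =
   (2 * q * (lin_map S y).1) -i* (2 * q * (lin_map S y).2).
  rewrite /z /phase_pt; move: (lin_map S y) (Num.sqrt 2) sq2 => [x1 x2] s s0 /=.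
  apply/eqP; rewrite eq_complex /=.
  by apply/andP; split; apply/eqP; field.
rewrite normc_phase_pt /lin_map /=; rewrite det2 in det; clear D0 z.
move: (S 0 0) (S 0 1) (S 1 0) (S 1 1) det => a b c d det; case: y => y1 y2 /=.
apply/eqP; rewrite eq_complex /= -subr_eq0 -[X in _ && X]subr_eq0.
apply/andP; split; apply/eqP.
- transitivity ((a * y1 + b * y2) * y1 * (1 - (a * d - b * c))); first by field.
  by rewrite det subrr mulr0.
- transitivity (- (c * y1 + d * y2) * y1 * (1 - (a * d - b * c))); first by field.
  by rewrite det subrr mulr0.
Qed.

(** The factor in front of the theta term depends neither on q nor on m, so it leaves the sum over m
    and any linear combination of kets. *)
Lemma kernel_theta_term (N : nat) (S : 'M[R]_2) (q : R) (y : R * R) (m : int) :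
  (0 < N)%N -> \det S = 1 ->
  let z := phase_pt (lin_map S y) in
  (-1) ^ m * bargmann_kernel j N S (q + m%:~R) z =
  kernel_cst N S * cexp ((pi * N%:R * normc z ^+ 2) +i* (pi * N%:R * (y.1 * y.2))) *
  theta_term N (width S) q y m.
Proof.
move=> N0 det z; rewrite /bargmann_kernel (kernel_exponent _ _ det) -/z.
have piN : (pi * N%:R : R) != 0 by rewrite gt_eqF// mulr_gt0 ?pi_gt0 ?ltr0n.
have D0 : S 1 1 +i* S 0 1 != 0.
  apply: contraL (width_den det) => /eqP [-> ->].
  by rewrite expr0n /= addr0 ltxx.
have hb : 2 * hbar R N = (pi * N%:R)^-1.
  by rewrite /hbar -mulrA invfM mulrA divff ?mul1r.
have -> (E : C) : ((2 * hbar R N)%:C * (S 1 1 +i* S 0 1))^-1 * ((S 1 1 +i* S 0 1) * E) =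
    (pi * N%:R)%:C * E.
  by rewrite hb fmorphV invfM invrK -mulrA mulKf.
have -> : (pi * N%:R)%:C * ((normc z ^+ 2) +i* (y.1 * y.2 - 2 * (q + m%:~R) * y.2)
     - width S * ((y.1 - (q + m%:~R)) ^+ 2)%:C) =
  ((pi * N%:R * normc z ^+ 2) +i* (pi * N%:R * (y.1 * y.2))) +
  (- (pi * N%:R)%:C * width S * ((y.1 - q - m%:~R) ^+ 2)%:C) +
  (0 +i* (2 * pi * (- (N%:R * (q + m%:~R)) * y.2))).
  move: (width S) (normc z) => [w1 w2] nz.
  by apply/eqP; rewrite eq_complex /=; apply/andP; split; apply/eqP; ring.
rewrite !cexpD -e2piE /kernel_cst /theta_term /gauss_term; ring.
Qed.

(** Only |j_S|^2 = |d + ib| enters, so the choice of the square root has no effect on the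
    density. *)
Lemma normc_kernel_cst (N : nat) (S : 'M[R]_2) : (0 < N)%N -> \det S = 1 ->
  normc (kernel_cst N S) ^+ 2 =
  Num.sqrt (2 * N%:R) / Num.sqrt (S 1 1 ^+ 2 + S 0 1 ^+ 2).
Proof.
move=> N0 det; have [_ /(_ S det) jS] := hj.
rewrite /kernel_cst normcM normc_real normcV exprMn !exprVn.
have -> : normc (j S) ^+ 2 = Num.sqrt (S 1 1 ^+ 2 + S 0 1 ^+ 2).
  by rewrite -normcX jS.
congr (_ * _); rewrite real_normK ?num_real// exprVn.
have -> : pi * hbar R N = (2 * N%:R)^-1.
  have pi0 : (pi : R) != 0 by rewrite gt_eqF// pi_gt0.
  by rewrite /hbar [2 * pi]mulrC -mulrA invfM mulrA divff// mul1r.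
have p0 : (0 : R) <= (2 * N%:R)^-1 by rewrite invr_ge0 mulr_ge0.
rewrite -powR_mulrn ?powR_ge0// -powRrM.
have -> : 1 / 4 * 2%:R = 2^-1 :> R by field.
by rewrite powR12_sqrt// sqrtrV ?mulr_ge0// invrK.
Qed.

Lemma Uket_theta (N : nat) (S : 'M[int]_2) (q : R) (y : R * R) :
  (0 < N)%N -> \det S = 1 ->
  let SR := map_mx intr S : 'M[R]_2 in
  let z := phase_pt (lin_map SR y) in
  Uket j N S q z =
  kernel_cst N SR * cexp ((pi * N%:R * normc z ^+ 2) +i* (pi * N%:R * (y.1 * y.2))) *
  theta N (width SR) q y.
Proof.
move=> N0 detS SR z.
have det : \det SR = 1 by rewrite /SR det_map_mx detS.
have w0 : 0 < complex.Re (width SR) by rewrite /= invr_gt0 width_den.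
rewrite /Uket /theta.
rewrite -(sumZ_scale _ _ (theta_dominated' N0 w0 q y)); last first.
  by rewrite expR_ge0 -[ltRHS]expR0 ltr_expR oppr_lt0 divr_gt0// !mulr_gt0 ?pi_gt0 ?ltr0n.
by congr sumZ; apply/funext => m; rewrite kernel_theta_term.
Qed.

(** The squared modulus of the common factor contains exp(2 pi N |z|^2), which the Husimi weight
    cancels exactly; a constant remains. *)
Lemma husimi_theta_comb (N p : nat) (S : 'M[int]_2) (Psi : C -> C) (c : 'I_p -> C)
    (l : 'I_p -> nat) (y : R * R) :
  (0 < N)%N -> (0 < p)%N -> \det S = 1 ->
  let SR := map_mx intr S : 'M[R]_2 in
  (forall z, Psi z = ((Num.sqrt p%:R)^-1)%:C *
     \sum_(s < p) c s * Uket j N S (1 / 2 - (l s)%:R / N%:R) z) ->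
  husimi N Psi (lin_map SR y) =
  Num.sqrt (2 * N%:R) / Num.sqrt (SR 1 1 ^+ 2 + SR 0 1 ^+ 2) / p%:R *
  normc (theta_comb N (width SR) c l y) ^+ 2.
Proof.
move=> N0 p0 detS SR HPsi.
have det : \det SR = 1 by rewrite /SR det_map_mx detS.
rewrite /husimi HPsi !Re_sqr_norm; set z := phase_pt _.
pose ph := cexp ((pi * N%:R * normc z ^+ 2) +i* (pi * N%:R * (y.1 * y.2))).
have -> : \sum_(s < p) c s * Uket j N S (1 / 2 - (l s)%:R / N%:R) z =
   kernel_cst N SR * ph * theta_comb N (width SR) c l y.
  rewrite /theta_comb mulr_sumr; apply: eq_bigr => s _.
  by rewrite /z Uket_theta// mulrCA.
have ph2 : normc ph ^+ 2 = expR (2 * pi * N%:R * normc z ^+ 2).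
  rewrite normc_cexp -expRM_natl; congr expR.
  by rewrite -[complex.Re _]/(pi * N%:R * normc z ^+ 2); ring.
rewrite normcM [normc (kernel_cst _ _ * _ * _)]normcM [normc (kernel_cst _ _ * _)]normcM.
rewrite !exprMn normc_kernel_cst// normc_real real_normK ?num_real// ph2.
rewrite exprVn sqr_sqrtr// expRN.
set e := expR _; have e0 : e != 0 by rewrite gt_eqF// expR_gt0.
set T := normc (theta_comb _ _ _ _ _) ^+ 2.
set K := _ / Num.sqrt _.
have pR : (p%:R : R) != 0 by rewrite pnatr_eq0 -lt0n.
by clearbody e T K; field; rewrite ?pR ?e0.
Qed.
End Kernel.

(** * Periodicity, lattice invariance and mass of the Husimi density *)

Section Husimi_torus.
Variables (R : realType) (j : 'M[R]_2 -> R[i]).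
Notation C := R[i].
Import ComplexField.Normc.
Hypothesis hj : root_choice j.
Variables (N p : nat) (S : 'M[int]_2) (Psi : C -> C) (c : 'I_p -> C) (l : 'I_p -> nat).
Hypotheses (N0 : (0 < N)%N) (p0 : (0 < p)%N) (detS : \det S = 1).
Hypotheses (lN : forall s, (l s < N)%N) (l_inj : injective l).
Hypothesis c1 : forall s, normc (c s) = 1.
Hypothesis PsiE : forall z, Psi z = ((Num.sqrt p%:R)^-1)%:C *
     \sum_(s < p) c s * Uket j N S (1 / 2 - (l s)%:R / N%:R) z.

Let SR : 'M[R]_2 := map_mx intr S.

Let detE : S 0 0 * S 1 1 - S 0 1 * S 1 0 = 1.
Proof. by rewrite -det2. Qed.

Let detRE : SR 0 0 * SR 1 1 - SR 0 1 * SR 1 0 = 1.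
Proof. by rewrite /SR !mxE -!intrM -intrB detE. Qed.

Let detR : \det SR = 1.
Proof. by rewrite det2. Qed.

Let w0 : 0 < complex.Re (width SR).
Proof. by rewrite /= invr_gt0 width_den. Qed.

Let G (y : R * R) : R := normc (theta_comb N (width SR) c l y) ^+ 2.

Let K : R := Num.sqrt (2 * N%:R) / Num.sqrt (SR 1 1 ^+ 2 + SR 0 1 ^+ 2) / p%:R.

(** In this section [S] stands for S_v, and [S'] is its inverse. Being integral, it transports the
    periodicity of [G] to the density. *)
Let S' : 'M[int]_2 := mx2 (S 1 1) (- S 0 1) (- S 1 0) (S 0 0).

Let inv_map (x : R * R) : R * R := ((S' 0 0)%:~R * x.1 + (S' 0 1)%:~R * x.2,
                                    (S' 1 0)%:~R * x.1 + (S' 1 1)%:~R * x.2).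

Let inv_mapE x : inv_map x = (SR 1 1 * x.1 - SR 0 1 * x.2, - SR 1 0 * x.1 + SR 0 0 * x.2).
Proof. by rewrite /inv_map /S' /SR !mxE /= !mulrNz; congr pair; ring. Qed.

Let husimiE x : husimi N Psi x = K * G (inv_map x).
Proof.
have -> : x = lin_map SR (inv_map x).
  case: x => x1 x2; rewrite inv_mapE /lin_map /=; congr pair.
  - by transitivity (x1 * (SR 0 0 * SR 1 1 - SR 0 1 * SR 1 0)); [rewrite detRE mulr1|ring].
  - by transitivity (x2 * (SR 0 0 * SR 1 1 - SR 0 1 * SR 1 0)); [rewrite detRE mulr1|ring].
have -> : inv_map (lin_map SR (inv_map x)) = inv_map x.
  rewrite [LHS]inv_mapE; case: (inv_map x) => y1 y2; rewrite /lin_map /=; congr pair.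
  - by transitivity (y1 * (SR 0 0 * SR 1 1 - SR 0 1 * SR 1 0)); [ring|rewrite detRE mulr1].
  - by transitivity (y2 * (SR 0 0 * SR 1 1 - SR 0 1 * SR 1 0)); [ring|rewrite detRE mulr1].
exact: (husimi_theta_comb hj _ N0 p0 detS PsiE).
Qed.

Let G_torus : torus_continuous G.
Proof.
split; first exact/ccontinuous_normc_sqr/theta_comb_ccontinuous.
move=> x y; split; rewrite /G; congr (_ ^+ 2).
- have -> : (x + 1, y) = (x, y) + (1, 0) :> R * R by congr pair; rewrite /= addr0.
  exact: normc_theta_comb_shift_fst.
- have -> : (x, y + 1) = (x, y) + (0, 1) :> R * R by congr pair; rewrite /= addr0.
  apply: (normc_theta_comb_shift_snd N0 w0 c _ (n1 := N%:Z)); first by rewrite mulr1.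
  by move=> s; exists (l s)%:Z; rewrite mulr1.
Qed.

Lemma husimi_torus_continuous : torus_continuous (husimi N Psi).
Proof.
have -> : husimi N Psi = (fun x => K * G (inv_map x)).
  by apply/funext => x; exact: husimiE.
apply: torus_continuousM; first exact: torus_continuous_cst.
exact: torus_continuous_linear.
Qed.

(** The second column of S_v is v, so the inverse matrix sends v/g to (0, 1/g), a translation under
    which all the theta functions involved acquire the same phase. *)
Lemma husimi_shift (g : nat) x : (0 < g)%N -> (g %| N)%N -> (forall s, (g %| l s)%N) ->
  husimi N Psi (x + ((S 0 1)%:~R / g%:R, (S 1 1)%:~R / g%:R)) = husimi N Psi x.
Proof.
move=> g0 gN gl; have gR : (g%:R : R) != 0 by rewrite pnatr_eq0 -lt0n.
have S01 : (S 0 1)%:~R = SR 0 1 by rewrite mxE.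
have S11 : (S 1 1)%:~R = SR 1 1 by rewrite mxE.
have dvd_int (n : nat) : (g %| n)%N -> exists n1 : int, n%:R * g%:R^-1 = n1%:~R :> R.
  by move=> /dvdnP[k ->]; exists k%:Z; rewrite natrM mulfK.
have [n1 e1] := dvd_int N gN.
rewrite !husimiE; congr (_ * _); rewrite /G; congr (_ ^+ 2).
have -> : inv_map (x + ((S 0 1)%:~R / g%:R, (S 1 1)%:~R / g%:R)) =
    inv_map x + (0, g%:R^-1).
  rewrite !inv_mapE S01 S11 /=; apply: injective_projections => /=; first ring.
  transitivity (- SR 1 0 * x.1 + SR 0 0 * x.2 +
    (SR 0 0 * SR 1 1 - SR 0 1 * SR 1 0) / g%:R); first ring.
  by rewrite detRE mul1r.
apply: (normc_theta_comb_shift_snd N0 w0 c _ e1) => s; exact: dvd_int.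
Qed.

(** The change of variables preserves the integral, and the mass of the combination is p
    sqrt(D/(2N)) with D = d^2 + b^2, the inverse of the constant [K]. *)
Lemma liouville_husimi : liouville_measure (husimi N Psi) = 1.
Proof.
have -> : husimi N Psi = (fun x => K * G (inv_map x)).
  by apply/funext => x; exact: husimiE.
have tGi : torus_continuous (fun x => G (inv_map x)) by exact: torus_continuous_linear.
rewrite liouvilleZl; last by case: tGi.
rewrite liouville_SL2//; last by rewrite /S' !mxE /=; rewrite -detE; ring.
rewrite /G theta_comb_mass//.
rewrite (eq_bigr (fun=> 1)); last by move=> s _; rewrite c1 expr1n.
rewrite sumr_const card_ord /K.
set D := SR 1 1 ^+ 2 + SR 0 1 ^+ 2.
have D0 : 0 < D by exact: width_den.
have NR : (0 : R) < N%:R by rewrite ltr0n.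
have pR : (p%:R : R) != 0 by rewrite pnatr_eq0 -lt0n.
have pi0 : (0 : R) < pi by exact: pi_gt0.
have -> : pi / (2 * (pi * N%:R * complex.Re (width SR))) = D / (2 * N%:R).
  rewrite -[complex.Re _]/(D^-1).
  have aux (a b d : R) : a != 0 -> b != 0 -> d != 0 ->
      a / (2 * (a * b * d^-1)) = d / (2 * b) by move=> a0 b0 d0; field; rewrite b0 d0 a0.
  by apply: aux; exact: lt0r_neq0.
have n2 : (0 : R) < 2 * N%:R by rewrite mulr_gt0.
rewrite [Num.sqrt (D / _)]sqrtrM ?(ltW D0)// sqrtrV ?(ltW n2)//.
have s1 : Num.sqrt D != 0 by rewrite gt_eqF// sqrtr_gt0.
have s2 : Num.sqrt (2 * N%:R) != 0 :> R by rewrite gt_eqF// sqrtr_gt0.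
clearbody D; move: (Num.sqrt D) (Num.sqrt (2 * N%:R)) s1 s2 => a b a0 b0.
by field; rewrite b0 pR a0.
Qed.

Lemma husimi_measure_prob_functional : prob_functional (husimi_measure N Psi).
Proof.
have tH := husimi_torus_continuous; have [cH _] := tH.
have H0 x : 0 <= husimi N Psi x.
  by rewrite /husimi Re_sqr_norm mulr_ge0 ?sqr_ge0 ?expR_ge0.
have tM f : torus_continuous f -> continuous (fun x => f x * husimi N Psi x).
  by move=> tf; have [] := torus_continuousM tf tH.
rewrite /husimi_measure; split.
- move=> f g tf tg; under eq_fun do rewrite mulrDl.
  by rewrite liouvilleD//; exact: tM.
- move=> r f tf; under eq_fun do rewrite -mulrA.
  by rewrite liouvilleZl//; exact: tM.
- move=> f g tf tg fg; apply: le_liouville; [exact: tM|exact: tM|].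
  by move=> x _; rewrite ler_wpM2r.
- by move=> r; rewrite liouvilleZl// liouville_husimi mulr1.
Qed.

End Husimi_torus.

Lemma husimi_measure_shift_invariant (R : realType) (N : nat) (Psi : R[i] -> R[i]) w :
  torus_continuous (husimi N Psi) ->
  (forall x, husimi N Psi (x + w) = husimi N Psi x) ->
  shift_invariant (husimi_measure N Psi) w.
Proof.
move=> tH Hw f tf; rewrite /husimi_measure.
rewrite -[RHS](liouville_shift_invariant w); last exact: torus_continuousM tf tH.
by congr liouville_measure; apply/funext => x; rewrite Hw.
Qed.

(** * Arithmetic of eigenmodules and of orbits modulo N *)

Section Residues.

(** Bridge from the group structure on ordinals to divisibility of integers, where all later
    congruences are handled. *)
Lemma val_residue_mulz (n : nat) (x : 'I_n.+1) (m : int) :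
  (n.+1 %| ((x *~ m : 'I_n.+1) : nat)%:Z - (x : nat)%:Z * m)%Z.
Proof.
have nat_case (k : nat) : (n.+1 %| ((x *+ k : 'I_n.+1) : nat)%:Z - (x : nat)%:Z * k%:Z)%Z.
  rewrite Zp_mulrn /= -modz_nat PoszM /modz; apply/dvdzP.
  by exists (- (divz ((x : nat)%:Z * k%:Z) n.+1%:Z)); ring.
case: m => k; first exact: nat_case.
rewrite NegzE mulrNz -pmulrn; set y := x *+ k.+1.
have [h|h] := posnP y.
- have -> : (- y : 'I_n.+1) = y.
    by apply: val_inj; rewrite /= h subn0 modnn.
  have := nat_case k.+1; rewrite -/y => d1.
  rewrite mulrN opprK -rpredN opprD -[X in (_ %| X)%Z]/(- y%:Z - _).
  by rewrite h oppr0 sub0r; move: d1; rewrite h sub0r.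
- have -> : ((- y : 'I_n.+1) : nat)%:Z = n.+1%:Z - y%:Z.
    rewrite /= modn_small; last by rewrite ltn_subrL h.
    by rewrite -subzn// ltnW.
  have := nat_case k.+1; rewrite -/y => d1.
  have -> : n.+1%:Z - y%:Z - (x : nat)%:Z * - k.+1%:Z =
     n.+1%:Z - (y%:Z - (x : nat)%:Z * k.+1%:Z) by ring.
  by rewrite rpredB.
Qed.

Lemma vec_mod_dvd (N : nat) (v w : 'cV[int]_2) (i : 'I_2) : (0 < N)%N ->
  vec_mod N v = vec_mod N w -> (N %| (v i 0 - w i 0)%R)%Z.
Proof.
case: N => // n _ /matrixP/(_ i 0); rewrite !mxE /= => E.
have val1 (m : int) : (n.+1 %| ((Zp1 *~ m : 'I_n.+1) : nat)%:Z - m)%Z.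
  have := val_residue_mulz (Zp1 : 'I_n.+1) m.
  have h : (n.+1 %| ((Zp1 : 'I_n.+1) : nat)%:Z - 1)%Z.
    (* In the trivial group [Zp1] has value 0 instead of 1, which is harmless modulo 1. *)
    by case: n {E m} => [|n]; rewrite ?dvd1z//= modn_small.
  move=> h'; have -> : ((Zp1 *~ m : 'I_n.+1) : nat)%:Z - m =
    (((Zp1 *~ m : 'I_n.+1) : nat)%:Z - ((Zp1 : 'I_n.+1) : nat)%:Z * m) +
    m * (((Zp1 : 'I_n.+1) : nat)%:Z - 1) by ring.
  by rewrite rpredD// dvdz_mull.
have -> : v i 0 - w i 0 = - (((Zp1 *~ v i 0 : 'I_n.+1) : nat)%:Z - v i 0) +
   (((Zp1 *~ w i 0 : 'I_n.+1) : nat)%:Z - w i 0) by rewrite E; ring.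
by rewrite rpredD// rpredN.
Qed.

(** The definition provides one generator that is an eigenvector, possibly not (k', k). Any other
    generator is a multiple of it modulo N, hence an eigenvector for the same lam. *)
Lemma eigenmodule_generator (S : 'M[int]_2) (N : nat) (L : {set 'cV[residue N]_2})
    (v : 'cV[int]_2) : (0 < N)%N ->
  free_principal_eigenmodule S L -> generated_by v L ->
  exists lam : int, forall i, (N %| ((S *m v) i 0 - lam * v i 0)%R)%Z.
Proof.
move=> N0 [_ [v0 [lam [gen0 Ev0]]]] gen; exists lam => i.
have /gen0[n En] : vec_mod N v \in L by apply/gen; exists 1; rewrite scale1r.
have d i' : (N %| (v i' 0 - n * v0 i' 0)%R)%Z by have := vec_mod_dvd i' N0 En; rewrite mxE.
have e i' : (N %| ((S *m v0) i' 0 - lam * v0 i' 0)%R)%Z.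
  by have := vec_mod_dvd i' N0 Ev0; rewrite [(lam *: v0) i' 0]mxE.
have -> : (S *m v) i 0 - lam * v i 0 =
   (\sum_k S i k * (v k 0 - n * v0 k 0)) + n * ((S *m v0) i 0 - lam * v0 i 0)
   - lam * (v i 0 - n * v0 i 0).
  rewrite !mxE; under [X in _ = X + _ - _]eq_bigr do rewrite mulrBr.
  rewrite sumrB; under [X in _ = _ - X + _ - _]eq_bigr do rewrite mulrCA.
  by rewrite -mulr_sumr; ring.
by rewrite rpredB ?rpredD ?rpred_sum ?dvdz_mull// => k _; exact: dvdz_mull.
Qed.

(** Since lam inverts lam' modulo g, divisibility by g goes back from one orbit element to the
    representative and from there to the whole orbit. *)
Lemma dvdz_orbit (n : nat) (g : nat) (lam lam' : int) (x : 'I_n.+1) (r s : nat) :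
  (g %| n.+1)%N -> (n.+1 %| lam * lam' - 1)%Z ->
  (g %| (x *~ (lam' ^+ r) : 'I_n.+1))%N -> (g %| (x *~ (lam' ^+ s) : 'I_n.+1))%N.
Proof.
move=> gn; have gz m : (n.+1 %| m)%Z -> (g %| m)%Z by apply: dvdz_trans.
move=> /gz inv hr.
have vg k : (g %| ((x *~ (lam' ^+ k) : 'I_n.+1) : nat)%:Z - (x : nat)%:Z * lam' ^+ k)%Z.
  by apply: gz; exact: val_residue_mulz.
have hx : (g %| (x : nat)%:Z)%Z.
  have h1 : (g %| (x : nat)%:Z * lam' ^+ r)%Z.
    have -> : (x : nat)%:Z * lam' ^+ r = ((x *~ (lam' ^+ r) : 'I_n.+1) : nat)%:Z -
      (((x *~ (lam' ^+ r) : 'I_n.+1) : nat)%:Z - (x : nat)%:Z * lam' ^+ r) by ring.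
    by rewrite rpredB.
  have h2 k : (g %| (lam * lam') ^+ k - 1)%Z.
    elim: k => [|k IH]; first by rewrite expr0 subrr dvdz0.
    have -> : (lam * lam') ^+ k.+1 - 1 =
      (lam * lam') * ((lam * lam') ^+ k - 1) + (lam * lam' - 1) by rewrite exprS; ring.
    by rewrite rpredD// dvdz_mull.
  have -> : (x : nat)%:Z = lam ^+ r * ((x : nat)%:Z * lam' ^+ r) -
      (x : nat)%:Z * ((lam * lam') ^+ r - 1) by rewrite exprMn; ring.
  by rewrite rpredB// dvdz_mull.
have h3 : (g %| ((x *~ (lam' ^+ s) : 'I_n.+1) : nat)%:Z)%Z.
  have -> : ((x *~ (lam' ^+ s) : 'I_n.+1) : nat)%:Z =
    (((x *~ (lam' ^+ s) : 'I_n.+1) : nat)%:Z - (x : nat)%:Z * lam' ^+ s) +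
    lam' ^+ s * (x : nat)%:Z by ring.
  by rewrite rpredD// dvdz_mull.
exact: h3.
Qed.

Lemma orbit_mulz_inj (n : nat) (lam' : int) (x : 'I_n.+1) (s s' : nat) :
  let p := order (fun y : 'I_n.+1 => y *~ lam') x in
  (s < p)%N -> (s' < p)%N ->
  x *~ (lam' ^+ s) = x *~ (lam' ^+ s') -> s = s'.
Proof.
set f := fun y : 'I_n.+1 => y *~ lam' => p sp s'p E.
have it k : iter k f x = x *~ (lam' ^+ k).
  by elim: k => [|k IH]; rewrite ?expr0 ?mulr1z//= IH /f -mulrzA exprSr.
have := orbit_uniq f x; rewrite /orbit -/p => u.
apply/eqP; rewrite -(nth_uniq x _ _ u) ?size_traject//.
by rewrite !nth_traject// !it E.
Qed.

(** The multiplier is the determinant of the columns S (u, w) and v = (k', k). Multiplying by lam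
    replaces v by S v modulo N, which gives det S times det S_v, that is 1. *)
Lemma multiplier_inverse (a b c d k' k u w lam : int) (N : nat) :
  a * d - b * c = 1 -> u * k - k' * w = 1 ->
  (N %| (a * k' + b * k - lam * k')%R)%Z -> (N %| (c * k' + d * k - lam * k)%R)%Z ->
  (N %| (lam * (k * (a * u + b * w) - k' * (c * u + d * w)) - 1)%R)%Z.
Proof.
move=> det1 det2 h1 h2.
have -> : lam * (k * (a * u + b * w) - k' * (c * u + d * w)) - 1 =
   (c * u + d * w) * (a * k' + b * k - lam * k') -
   (a * u + b * w) * (c * k' + d * k - lam * k) +
   ((a * d - b * c) * (u * k - k' * w) - 1) by ring.
by rewrite det1 det2 mulr1 subrr addr0 rpredB// dvdz_mull.
Qed.

Lemma normc_crystal_coef (R : realType) (c0 : R[i]) sg r p sgj s :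
  `|c0| = 1 -> ComplexField.Normc.normc (crystal_coef c0 sg r p sgj s) = 1.
Proof.
move=> c01; elim: s => [|s IH] /=; first by case: c01.
by rewrite !ComplexField.Normc.normcM !normc_e2pi IH !mul1r.
Qed.
End Residues.

Theorem proposition5 (R : realType) (j : 'M[R]_2 -> R[i]) (hj : root_choice j)
  (S : 'M[int]_2) (hS : Gamma12 S) (htr : 2 < \tr S)
  (A : set nat) (hAinf : infinite_set A)
  (hA : forall N, A N -> odd N /\ admissible S N)
  (l : forall N : nat, residue N) (Psi : nat -> R[i] -> R[i])
  (hPsi : forall N, A N -> crystal_eigenstate j S (l N) (Psi N))
  (hg : gcdn N (l N) @[N --> within A \oo] --> \oo) :
  weak_star_cvg A (fun N => husimi_measure N (Psi N)) (@liouville_measure R) /\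
  forall pts : (forall N : nat, 'I_N -> R * R),
    (forall N, A N -> zeros_list (Psi N) (pts N)) ->
    weak_star_cvg A (fun N => atomic_measure (pts N)) (@liouville_measure R).
Proof.
have detS : S 0 0 * S 1 1 - S 0 1 * S 1 0 = 1 by case: hS => + _; rewrite det2.
have trS : 2 < S 0 0 + S 1 1.
  by move: htr; rewrite /mxtrace !big_ord_recl big_ord0 addr0; congr (_ < S _ _ + S _ _);
    apply: val_inj.
(* Everything the two convergence statements need from the quantum side, for one N. The vector (k',
   k) and lam come from the data of the crystal state itself. *)
have key N : A N -> [/\ (0 < N)%N, torus_continuous (husimi N (Psi N)),
    prob_functional (husimi_measure N (Psi N)) & exists k' k lam : int,
    [/\ coprimez k' k,
        (gcdn N (l N) %| (S 0 0 * k' + S 0 1 * k - lam * k')%R)%Z,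
        (gcdn N (l N) %| (S 1 0 * k' + S 1 1 * k - lam * k)%R)%Z &
        forall x, husimi N (Psi N) (x + (k'%:~R / (gcdn N (l N))%:R,
           k%:~R / (gcdn N (l N))%:R)) = husimi N (Psi N) x]].
  move=> AN; have [oN _] := hA N AN; have N0 : (0 < N)%N by case: N oN {AN}.
  have [L [k' [k [u [w [sigma [l0 [r [c0]]]]]]]]] := hPsi N AN.
  case=> -[eigL gen cop _ [detSv _]] [_ rp lr c01 PhiE].
  set lam' := k * (S 0 0 * u + S 0 1 * w) - k' * (S 1 0 * u + S 1 1 * w).
  have [lam Elam] := eigenmodule_generator N0 eigL gen.
  have E1 : (N %| (S 0 0 * k' + S 0 1 * k - lam * k')%R)%Z.
    have := Elam 0; rewrite !mxE !big_ord_recl big_ord0 !mxE /= addr0.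
    by congr (_ %| S _ _ * _ + S _ _ * _ - _)%Z; apply: val_inj.
  have E2 : (N %| (S 1 0 * k' + S 1 1 * k - lam * k)%R)%Z.
    have := Elam 1; rewrite !mxE !big_ord_recl big_ord0 !mxE /= addr0.
    by congr (_ %| S _ _ * _ + S _ _ * _ - _)%Z; apply: val_inj.
  have uk : u * k - k' * w = 1 by move: detSv; rewrite det2 !mxE.
  have invl : (N %| (lam * lam' - 1)%R)%Z by exact: multiplier_inverse.
  have NE : N.-1.+1 = N by rewrite prednK.
  set f := (fun x : residue N => x *~ lam') in rp PhiE.
  set p := order f l0 in rp PhiE.
  have p0 : (0 < p)%N by exact: order_gt0.
  set sgj := \sum_(s < _) _ in PhiE.
  pose c (s : 'I_p) := crystal_coef c0 (sigma \o (fun s => l0 *~ (lam' ^+ s))) r p sgj s.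
  pose ls (s : 'I_p) : nat := (l0 *~ (lam' ^+ s) : residue N).
  pose Sv := mx2 u k' w k.
  have lN s : (ls s < N)%N by rewrite -[ltnRHS]NE ltn_ord.
  have l_inj : injective ls.
    by move=> s s' /val_inj E; apply: val_inj; apply: orbit_mulz_inj E => //; exact: ltn_ord.
  have c1 s : ComplexField.Normc.normc (c s) = 1 by exact: normc_crystal_coef.
  have PsiE z : Psi N z = ((Num.sqrt p%:R)^-1)%:C *
     \sum_(s < p) c s * Uket j N Sv (1 / 2 - (ls s)%:R / N%:R) z by rewrite PhiE.
  have g0 : (0 < gcdn N (l N))%N by rewrite gcdn_gt0 N0.
  have gN : (gcdn N (l N) %| N)%N by exact: dvdn_gcdl.
  have gls s : (gcdn N (l N) %| ls s)%N.
    (* The index l(N), divisible by g, is the orbit element number r, while the orbit is described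
       from its representative l0. *)
    apply: (@dvdz_orbit N.-1 _ lam lam' l0 r).
    - by rewrite [X in (_ %| X)%N]NE.
    - by rewrite NE.
    - by have := dvdn_gcdr N (l N); rewrite [X in (_ %| nat_of_ord X)%N -> _]lr.
  split=> //.
  - exact: (husimi_torus_continuous hj N0 p0 detSv PsiE).
  - exact: (husimi_measure_prob_functional hj N0 p0 detSv lN l_inj c1 PsiE).
  - exists k', k, lam; split=> //; try exact: dvdz_trans E1; try exact: dvdz_trans E2.
    move=> x; have := husimi_shift hj N0 p0 detSv PsiE x g0 gN gls.
    by rewrite !mxE.
split.
  apply: (crystal_equidistribution detS trS hg) => N AN.
  have [N0 tH pH [k' [k [lam [cop d1 d2 inv]]]]] := key N AN.
  split=> //; exists k', k, lam; split=> //.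
  exact: husimi_measure_shift_invariant.
move=> pts hpts; apply: (crystal_equidistribution detS trS hg) => N AN.
have [N0 tH pH [k' [k [lam [cop d1 d2 inv]]]]] := key N AN.
split; first exact: atomic_prob_functional.
exists k', k, lam; split=> //.
apply: (atomic_shift_invariant _ inv (hpts N AN)) => x m n.
exact: torus_periodic.
Qed.
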